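(* Let $\mu\in\mathbb{R}^p$ be deterministic, $l=(l_1,\dots,l_n)\in\{-1,1\}^n$, and $\sigma_1,\dots,\sigma_p\ge 0$. Observe $Y_j=l_j\mu+\varepsilon_j$, $j=1,\dots,n$, where $\varepsilon_j=(\varepsilon_{1j},\dots,\varepsilon_{pj})^\top$ and all $\varepsilon_{ij}\sim N(0,\sigma_i^2)$ are independent. Let $Y\in\mathbb{R}^{n\times p}$ be the matrix with rows $Y_1^\top,\dots,Y_n^\top$, let $\hat v$ be a unit-norm leading eigenvector of $YY^\top$, and set $\hat l_j=\mathrm{sgn}(\hat v_j)$, $j=1,\dots,n$. Let $\sigma_*=\max_i\sigma_i$ and $\tilde\sigma=(\sum_i\sigma_i^4)^{1/4}$. Then there is a universal constant $C>0$ such that \[ \mathbb{E}\,\mathcal{M}(l,\hat l)\le C\left(\frac{n\|\mu\|_2\sigma_*+n\sigma_*^2+\sqrt n\,\tilde\sigma^2}{n\|\mu\|_2^2}\wedge 1\right). \]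
   Context: The misclassification rate is $\mathcal{M}(l,\hat l)=\frac1n\min\{\sum_{i=1}^n 1_{\{l_i\ne\hat l_i\}},\ \sum_{i=1}^n 1_{\{l_i\ne-\hat l_i\}}\}$. $a\wedge b=\min(a,b)$. *)

(* Defs.v *)
From HB Require Import structures.
From mathcomp Require Import all_boot all_order all_algebra.
From mathcomp Require Import all_classical all_reals all_analysis.
Set Implicit Arguments. Unset Strict Implicit. Unset Printing Implicit Defensive.
Import Order.TTheory GRing.Theory Num.Theory.
Local Open Scope classical_set_scope.
Local Open Scope ring_scope.

(* Law of N(0, s^2) on R; for s = 0 it is the Dirac mass at 0
   (the library's normal_prob uses a dummy density when s = 0). *)
Definition gauss_law {R : realType} (s : R) : set R -> \bar R :=
  if s == 0 then (\d_(0:R))%classic : set R -> \bar R else normal_prob 0 s.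

Definition mutually_independent {R : realType} (d : measure_display)
  (T : measurableType d) (P : probability T R) (I : finType)
  (X : I -> T -> R) : Prop :=
  forall B : I -> set R, (forall i, measurable (B i)) ->
    P (\bigcap_(i in [set: I]) (X i @^-1` B i)) =
    (\prod_(i : I) P (X i @^-1` B i))%E.

Definition unit_leading_eigvec {R : realType} (n : nat) (A : 'M[R]_n)
  (v : 'rV[R]_n) : Prop :=
  \sum_(j < n) v 0 j ^+ 2 = 1 /\
  exists a : R, v *m A = a *: v /\ (forall b, eigenvalue A b -> b <= a).

Definition misclass {R : realType} (n : nat) (l lh : 'I_n -> R) : R :=
  n%:R^-1 * Num.min (\sum_(j < n) ((l j != lh j)%:R : R))
                    (\sum_(j < n) ((l j != - lh j)%:R : R)).

(* the bound (A / B) /\ 1, with the convention x/0 = +oo, i.e. the min is 1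
   when the denominator n ||mu||^2 vanishes *)
Definition min1_ratio {R : realType} (num den : R) : R :=
  if den == 0 then 1 else Num.min (num / den) 1.

Definition l2norm {R : realType} (p : nat) (mu : 'I_p -> R) : R :=
  Num.sqrt (\sum_(i < p) mu i ^+ 2).
Definition sigma_star {R : realType} (p : nat) (s : 'I_p -> R) : R :=
  \big[Num.max/0]_(i < p) s i.
Definition sigma_tilde_sq {R : realType} (p : nat) (s : 'I_p -> R) : R :=
  Num.sqrt (\sum_(i < p) s i ^+ 4).

(* Main.v *)
Require Import Defs.
From HB Require Import structures.
From mathcomp Require Import all_boot all_order all_algebra.
From mathcomp Require Import all_classical all_reals all_analysis.
From mathcomp Require Import finmap measurable_realfun ring lra.
Import Order.TTheory GRing.Theory Num.Theory.
Import numFieldNormedType.Exports.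
Local Open Scope classical_set_scope.
Local Open Scope ring_scope.
Set Implicit Arguments. Unset Strict Implicit. Unset Printing Implicit Defensive.

(* Write [Y^T u = <u, l> mu + eps^T u] and let [G u] be the random part of
   [|Y^T u|^2] on the unit sphere. Comparing the maximizer [v] of [|Y^T u|^2]
   with [l / sqrt n] gives [|mu|^2 (n - <v, l>^2) <= G v - G (l / sqrt n)], and
   the misclassification rate is at most [2 (1 - <v, l>^2 / n)]; this linear
   bound is all that is needed, no perturbation theory for eigenvectors enters.
   The supremum of the quadratic form [G] is controlled by rounding [v] to the
   lattice [n^(-1/2) Z^n]: since [G] has explicit diagonal entries [G e_j], the
   coordinates can be rounded one after the other in the direction in which the
   linear part increases, at a cost of [(1/n) \sum_j (G e_j)^-]. There are at
   most [64^n] lattice points of norm at most 2, and each [expR (lam * G x)] has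
   a bounded mean by Gaussian linearization of squares. The inequality
   [y <= a + expR (y - a)] turns these exponential moments into a bound on the
   mean of the supremum, without tail integration; the remaining part of
   [- G (l / sqrt n)] consists of off-diagonal products of mean zero. *)

(** * Independence and transfer of integrals *)

Section NonnegativeIntegral.
Local Open Scope ereal_scope.
Context (R : realType) (d : measure_display) (T : measurableType d).

Lemma measurable_fun_prod (I : Type) (s : seq I) (Q : pred I) (h : I -> T -> R) :
  (forall i, measurable_fun setT (h i)) ->
  measurable_fun setT (fun w => (\prod_(i <- s | Q i) h i w)%R).
Proof.
move=> mh; elim: s => [|i s IH].
  by under eq_fun do rewrite big_nil; exact: measurable_cst.
under eq_fun do rewrite big_cons.
by case: (Q i) => //; exact: measurable_funM.
Qed.

Lemma measurable_fun_sum (I : Type) (s : seq I) (Q : pred I) (h : I -> T -> R) :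
  (forall i, measurable_fun setT (h i)) ->
  measurable_fun setT (fun w => (\sum_(i <- s | Q i) h i w)%R).
Proof.
move=> mh; elim: s => [|i s IH].
  by under eq_fun do rewrite big_nil; exact: measurable_cst.
under eq_fun do rewrite big_cons.
by case: (Q i) => //; exact: measurable_funD.
Qed.

Lemma ge0_integralZl_real (mu : {measure set T -> \bar R}) (k : R)
  (f : T -> R) : (0 <= k)%R ->
  measurable_fun setT f -> (forall w, 0 <= f w)%R ->
  \int[mu]_w (k * f w)%:E = k%:E * \int[mu]_w (f w)%:E.
Proof.
move=> k0 mf f0; under eq_integral do rewrite EFinM.
rewrite ge0_integralZl_EFin//; last exact/measurable_EFinP.
by move=> w _; rewrite lee_fin.
Qed.

End NonnegativeIntegral.

Section IntegralTransfer.
Local Open Scope ereal_scope.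
Context (R : realType) (d : measure_display) (T : measurableType d)
  (d' : measure_display) (U : measurableType d').

Import HBNNSimple.

(* With [g = 1] this transfers a law, with [X = id] it integrates against a
   density, and with [g] independent of [X] it factors an expectation. *)
Lemma ge0_integral_transfer (mu : {measure set T -> \bar R})
  (nu : {measure set U -> \bar R}) (X g : T -> R) (Z : U -> R) (c : R) :
  (0 <= c)%R -> measurable_fun setT X -> measurable_fun setT Z ->
  measurable_fun setT g -> (forall w, 0 <= g w)%R ->
  (forall B, measurable B ->
    \int[mu]_w (\1_B (X w) * g w)%:E = \int[nu]_z (\1_B (Z z))%:E * c%:E) ->
  forall f : R -> R, measurable_fun setT f ->
    (forall x, 0 <= f x)%R ->
  \int[mu]_w (f (X w) * g w)%:E = \int[nu]_z (f (Z z))%:E * c%:E.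
Proof.
move=> c0 mX mZ mg g0 ind f mf f0.
have mef : measurable_fun setT (EFin \o f) by exact/measurable_EFinP.
(* Indicators extend to simple functions by linearity; simple functions increasing to [f] then give
   the claim by monotone convergence on both sides. *)
pose h := nnsfun_approx measurableT mef.
have hcvg x : (h n x)%:E @[n --> \oo] --> (f x)%:E.
  by apply: (cvg_nnsfun_approx measurableT mef) => // y _; rewrite lee_fin.
have mh n : measurable_fun setT (fun w => h n (X w)).
  by apply: measurableT_comp.
have hnd x : nondecreasing_seq (fun n => h n x).
  by move=> m n mn; have /lefP := nd_nnsfun_approx measurableT mef mn; exact.
have mhZ n : measurable_fun setT (fun z => h n (Z z)).
  by apply: measurableT_comp.
have simple n :
    \int[mu]_w (h n (X w) * g w)%:E = \int[nu]_z (h n (Z z))%:E * c%:E.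
  pose s := fset_set (range (h n)).
  have hE x : h n x = (\sum_(y <- s) y * \1_(h n @^-1` [set y]) x)%R.
    by rewrite (fimfunE (h n)) fsbig_finite//; exact: fimfunP.
  have mind y : measurable (h n @^-1` [set y]) by exact: measurable_sfunP.
  have mxind y : measurable_fun setT (fun w => \1_(h n @^-1` [set y]) (X w) : R).
    by apply: measurableT_comp => //; exact: measurable_indic.
  have mzind y : measurable_fun setT (fun z => \1_(h n @^-1` [set y]) (Z z) : R).
    by apply: measurableT_comp => //; exact: measurable_indic.
  have sE k : k \in s -> (0 <= k)%R.
    rewrite in_fset_set; last exact: fimfunP.
    by move=> /set_mem[x _ <-]; exact: fun_ge0.
  transitivity (\sum_(y <- s)
      (y%:E * (\int[nu]_z (\1_(h n @^-1` [set y]) (Z z))%:E * c%:E))).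
    (* [ge0_integral_sum] asks for nonnegative summands at every index, also outside [s]; the
       absolute value ensures this and changes nothing on [s]. *)
    transitivity (\int[mu]_w (\sum_(y <- s)
        (`|y| * (\1_(h n @^-1` [set y]) (X w) * g w))%:E)).
      apply: eq_integral => w _; rewrite sumEFin hE mulr_suml; congr EFin.
      by apply: eq_big_seq => y ys; rewrite ger0_norm ?sE// mulrA.
    rewrite ge0_integral_sum//.
    - apply: eq_big_seq => y ys; rewrite -ind//.
      rewrite ge0_integralZl_real ?ger0_norm ?sE//; first exact: measurable_funM.
      by move=> w; rewrite mulr_ge0.
    - by move=> y; apply/measurable_EFinP/measurable_funM => //; exact: measurable_funM.
    - by move=> y w _; rewrite lee_fin !mulr_ge0.
  transitivity ((\sum_(y <- s)
      (y%:E * \int[nu]_z (\1_(h n @^-1` [set y]) (Z z))%:E)) * c%:E).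
    rewrite big_seq [X in _ = X * _]big_seq ge0_sume_distrl//.
      by apply: eq_bigr => y _; rewrite muleA.
    move=> y ys; rewrite mule_ge0// ?lee_fin ?sE//; apply: integral_ge0 => z _.
    by rewrite lee_fin.
  congr (_ * _).
  transitivity (\int[nu]_z (\sum_(y <- s)
        (`|y| * (\1_(h n @^-1` [set y]) (Z z)))%:E)).
    rewrite ge0_integral_sum//.
    - apply: eq_big_seq => y ys.
      by rewrite ge0_integralZl_real ?ger0_norm ?sE.
    - by move=> y; apply/measurable_EFinP/measurable_funM.
  apply: eq_integral => w _; rewrite sumEFin hE; congr EFin.
  by apply: eq_big_seq => y ys; rewrite ger0_norm ?sE.
have lim1 : \int[nu]_z (h n (Z z))%:E @[n --> \oo] --> \int[nu]_z (f (Z z))%:E.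
  under [X in _ --> X]eq_integral => z _ do
    rewrite -(cvg_lim (@ereal_hausdorff R) (hcvg (Z z))).
  apply: cvg_monotone_convergence => //.
  - by move=> n; exact/measurable_EFinP.
  - by move=> n w _; rewrite lee_fin.
  - by move=> w _ m n mn; rewrite lee_fin; exact: hnd.
have lim2 : \int[mu]_w (h n (X w) * g w)%:E @[n --> \oo] -->
    \int[mu]_w (f (X w) * g w)%:E.
  have hcvg2 w : (h n (X w) * g w)%:E @[n --> \oo] --> (f (X w) * g w)%:E.
    apply: cvg_EFin; first by near=> n.
    by apply: cvgMl; have /fine_cvg := hcvg (X w); exact.
  under [X in _ --> X]eq_integral => w _ do
    rewrite -(cvg_lim (@ereal_hausdorff R) (hcvg2 w)).
  apply: cvg_monotone_convergence => //.
  - by move=> n; exact/measurable_EFinP/measurable_funM.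
  - by move=> n w _; rewrite lee_fin mulr_ge0.
  - by move=> w _ m n mn; rewrite lee_fin ler_wpM2r//; exact: hnd.
have lim3 : \int[nu]_z (h n (Z z))%:E * c%:E @[n --> \oo] -->
    \int[nu]_z (f (Z z))%:E * c%:E by exact: cvgeZr.
apply: (cvg_unique (@ereal_hausdorff R) lim2).
rewrite (_ : (fun n => _) = fun n => \int[nu]_z (h n (Z z))%:E * c%:E)//.
exact/funext.
Unshelve. all: by end_near.
Qed.

End IntegralTransfer.

Section Independence.
Local Open Scope ereal_scope.
Context (R : realType) (d : measure_display) (T : measurableType d)
  (P : probability T R).

(** Independence is a product formula for indicators; the indicators are replaced by general
    functions one index at a time. Finite integrals keep the product of the other factors a real
    constant, as the transfer lemma requires. *)
Lemma integral_prod_indep (I : finType) (X : I -> T -> R) (f : I -> R -> R) :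
  (forall i, measurable_fun setT (X i)) -> mutually_independent P X ->
  (forall i, measurable_fun setT (f i)) -> (forall i x, 0 <= f i x)%R ->
  (forall i, \int[P]_w (f i (X i w))%:E < +oo) ->
  \int[P]_w (\prod_i f i (X i w))%:E = \prod_i \int[P]_w (f i (X i w))%:E.
Proof.
move=> mX indX mf f0 ffin.
have mpre B i : measurable B -> measurable (X i @^-1` B).
  by move=> mB; rewrite -[X in measurable X]setTI; exact: mX.
(* Outside [s] the functions are indicators, so the empty list is the definition of independence and
   [enum I] is the claim. *)
suff H (s : seq I) : forall f : I -> R -> R,
    (forall i, measurable_fun setT (f i)) -> (forall i x, 0 <= f i x)%R ->
    (forall i, \int[P]_w (f i (X i w))%:E < +oo) ->
    (forall i, i \notin s -> exists2 B, measurable B & f i = \1_B) ->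
    \int[P]_w (\prod_i f i (X i w))%:E = \prod_i \int[P]_w (f i (X i w))%:E.
  by apply: (H (enum I)) => // i; rewrite mem_enum.
elim: s => [|i0 s IH] {mf f0 ffin}f mf f0 ffin find.
  have /choice[B HB] : forall i, exists B, measurable B /\ f i = \1_B.
    by move=> i; have [|B] := find i => //; exists B.
  have mB i : measurable (B i) by have [] := HB i.
  transitivity (P (\bigcap_(i in [set: I]) (X i @^-1` B i))).
    rewrite -[X in P X]setIT -integral_indic//; last first.
      by apply: fin_bigcap_measurable => // i _; exact: mpre.
    apply: eq_integral => w _; congr EFin.
    rewrite indicE; case: (boolP (w \in _)) => [/set_mem wB|/negP wB].
      rewrite big1// => i _; have [_ ->] := HB i.
      by rewrite indicE mem_set//; exact: wB.
    have [i iB] : exists i, ~ B i (X i w).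
      by apply/existsNP => wB'; apply: wB; apply/mem_set => i _; exact: wB'.
    by rewrite (bigD1 i)//=; have [_ ->] := HB i; rewrite indicE memNset// mul0r.
  rewrite indX//; apply: eq_bigr => i _; have [_ ->] := HB i.
  by rewrite -[X in P X]setIT -integral_indic//; exact: mpre.
(* With an indicator in slot [i0] the induction hypothesis applies; it is the hypothesis on sets of
   [ge0_integral_transfer], with the product of the other factors as [g]. *)
pose fB B i := if i == i0 then \1_B else f i : R -> R.
have mfB B i : measurable B -> measurable_fun setT (fB B i).
  by move=> mB; rewrite /fB; case: eqP => // _; exact: measurable_indic.
have fB0 B i x : (0 <= fB B i x)%R by rewrite /fB; case: eqP.
have P1 B : measurable B -> \int[P]_w (\1_B (X i0 w))%:E = P (X i0 @^-1` B).
  by move=> mB; rewrite -[X in _ = P X]setIT -integral_indic//; exact: mpre.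
have fBfin B i : measurable B -> \int[P]_w (fB B i (X i w))%:E < +oo.
  rewrite /fB; case: eqP => [-> mB|//]; rewrite P1//.
  by rewrite (le_lt_trans (probability_le1 P (mpre _ _ mB)))// ltry.
have prodB B : measurable B ->
    \int[P]_w (\1_B (X i0 w) * \prod_(i | i != i0) f i (X i w))%:E =
    P (X i0 @^-1` B) * \prod_(i | i != i0) \int[P]_w (f i (X i w))%:E.
  move=> mB; have := IH (fB B) (fun i => mfB B i mB) (fB0 B)
    (fun i => fBfin B i mB).
  have find' : forall i, i \notin s -> exists2 B', measurable B' & fB B i = \1_B'.
    move=> i si; rewrite /fB; case: eqP => [_|/eqP ii0]; first by exists B.
    by apply: find; rewrite in_cons negb_or ii0.
  move=> /(_ find').
  move=> IHB.
  transitivity (\int[P]_w (\prod_i fB B i (X i w))%:E).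
    apply: eq_integral => w _; congr EFin; rewrite [RHS](bigD1 i0)//= /fB eqxx.
    by congr (_ * _)%R; apply: eq_bigr => i /negbTE ->.
  rewrite IHB (bigD1 i0)//= -P1//; congr (_ * _).
    by apply: eq_integral => w _; rewrite /fB eqxx.
  apply: eq_bigr => i /negbTE ii0.
  by apply: eq_integral => w _; rewrite /fB ii0.
have cfin : \prod_(i | i != i0) \int[P]_w (f i (X i w))%:E \is a fin_num.
  apply: (big_ind (fun x => x \is a fin_num)) => //.
    by move=> x y xfin yfin; rewrite fin_numM.
  move=> i _; rewrite ge0_fin_numE//; apply: integral_ge0 => w _.
  by rewrite lee_fin.
rewrite [RHS](bigD1 i0)//= -(fineK cfin) -(@ge0_integral_transfer _ _ _ _ _ P P (X i0)
  (fun w => (\prod_(i | i != i0) f i (X i w))%R))//.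
- by apply: eq_integral => w _; rewrite (bigD1 i0).
- apply: fine_ge0; apply: (big_ind (fun x => 0 <= x)) => //.
    by move=> x y x0 y0; exact: mule_ge0.
  by move=> i _; apply: integral_ge0 => w _; rewrite lee_fin.
- by apply: measurable_fun_prod => i; exact: measurableT_comp.
- move=> w; apply: (big_ind (fun x : R => 0 <= x)%R) => // x y x0 y0.
  exact: mulr_ge0.
- by move=> B mB; rewrite fineK// prodB// P1.
Qed.

End Independence.

(** * Gaussian exponential moments *)

Section Gaussian.
Local Open Scope ereal_scope.
Context (R : realType).
Implicit Types (a b m s t : R).

Lemma integral_normal_prob m s (f : R -> R) :
  measurable_fun setT f -> (forall x, 0 <= f x)%R ->
  \int[normal_prob m s]_x (f x)%:E =
  \int[lebesgue_measure]_x (f x * normal_pdf m s x)%:E.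
Proof.
move=> mf f0; rewrite -[LHS]mule1.
rewrite -(@ge0_integral_transfer _ _ _ _ _ lebesgue_measure (normal_prob m s)
  id (normal_pdf m s) id)//.
- exact: measurable_normal_pdf.
- by move=> x; exact: normal_pdf_ge0.
- move=> B mB; rewrite mule1 [RHS]integral_indic// setIT.
  rewrite [RHS]integral_mkcond; apply: eq_integral => x _.
  by rewrite patchE indicE; case: ifP => _; rewrite ?mul1r ?mul0r.
Qed.

(** Completing the square: the integrand times the density is a constant times the density of mean
    [m] and standard deviation [tau], which integrates to 1. *)
Lemma integral_normal_exp_quad a b s : s != 0%R -> (0 < 1 - 2 * a * s ^+ 2)%R ->
  \int[normal_prob 0 s]_x (expR (a * x ^+ 2 + b * x))%:E =
  ((Num.sqrt (1 - 2 * a * s ^+ 2))^-1 *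
   expR (b ^+ 2 * s ^+ 2 / (2 * (1 - 2 * a * s ^+ 2))))%:E.
Proof.
move=> s0; set t := (1 - _)%R => t0.
have tN0 : t != 0%R by rewrite gt_eqF.
have st0 : (0 < Num.sqrt t)%R by rewrite sqrtr_gt0.
have ss0 : (0 < s ^+ 2)%R by rewrite exprn_even_gt0.
pose tau := (s / Num.sqrt t)%R; pose m := (b * s ^+ 2 / t)%R.
have tau0 : tau != 0%R by rewrite mulf_neq0// invr_eq0 gt_eqF.
have tau2 : (tau ^+ 2 = s ^+ 2 / t)%R.
  by rewrite /tau exprMn exprVn sqr_sqrtr// ltW.
rewrite integral_normal_prob; last 2 first.
- apply: measurableT_comp => //; apply: measurable_funD => //.
  by apply: measurable_funM.
- by move=> x; exact: expR_ge0.
set c := (X in _ = X%:E); rewrite -[RHS]mule1 -(@integral_normal_pdf _ m tau).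
rewrite -ge0_integralZl_real; first last.
- by move=> x; exact: normal_pdf_ge0.
- exact: measurable_normal_pdf.
- by rewrite mulr_ge0 ?invr_ge0 ?sqrtr_ge0 ?expR_ge0.
apply: eq_integral => x _; congr EFin.
rewrite !normal_pdfE//.
have -> : normal_peak tau = (Num.sqrt t * normal_peak s)%R.
  rewrite /normal_peak tau2.
  have -> : (s ^+ 2 / t * pi *+ 2 = s ^+ 2 * pi *+ 2 * t^-1)%R by ring.
  rewrite sqrtrM; last by rewrite mulrn_wge0// mulr_ge0 ?pi_ge0// ltW.
  by rewrite invfM sqrtrV ?invrK ?(ltW t0)// mulrC.
rewrite /normal_fun.
rewrite [LHS]mulrCA.
set E := expR (- (x - m) ^+ 2 / _).
have -> : (c * (Num.sqrt t * normal_peak s * E) =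
    normal_peak s * (expR (b ^+ 2 * s ^+ 2 / (2 * t)) * E))%R.
  by rewrite /c; field; exact: lt0r_neq0.
rewrite /E; congr (_ * _)%R; rewrite -!expRD tau2; congr expR; rewrite /m.
have -> : (a = (1 - t) / (2 * s ^+ 2))%R by rewrite /t; field.
by field; rewrite s0 tN0.
Qed.

(** After squaring, [1 + x <= expR x] reduces the claim to [1 <= 1 + 4 * u ^+ 2 * (1 - 4 * u)].
    Negative [u] is allowed, which serves the lower deviations in [mgf_diag_form]. *)
Lemma inv_sqrt_le_expR (u : R) : (u <= 1 / 4)%R ->
  ((Num.sqrt (1 - 2 * u))^-1 <= expR (u + 4 * u ^+ 2))%R.
Proof.
move=> u4; have t0 : (0 < 1 - 2 * u)%R by lra.
rewrite -[leLHS]mul1r ler_pdivrMr ?sqrtr_gt0//.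
rewrite -(@ler_pXn2r _ 2) ?nnegrE ?mulr_ge0 ?expR_ge0 ?sqrtr_ge0//.
rewrite expr1n exprMn sqr_sqrtr ?(ltW t0)// -expRM_natl.
have e1 := expR_ge1Dx (2%:R * (u + 4 * u ^+ 2)).
apply: (le_trans _ (ler_wpM2r (ltW t0) e1)).
have -> : ((1 + 2 * (u + 4 * u ^+ 2)) * (1 - 2 * u) =
  1 + 4 * u ^+ 2 * (1 - 4 * u))%R by ring.
rewrite lerDl mulr_ge0//; last by lra.
by rewrite mulr_ge0 ?sqr_ge0.
Qed.

Lemma integral_normal_exp_quad_le a b s : s != 0%R -> (a * s ^+ 2 <= 1 / 4)%R ->
  \int[normal_prob 0 s]_x (expR (a * x ^+ 2 + b * x))%:E <=
  (expR (a * s ^+ 2 + 4 * (a * s ^+ 2) ^+ 2 + b ^+ 2 * s ^+ 2))%:E.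
Proof.
move=> s0 as4; have t0 : (1 / 2 <= 1 - 2 * a * s ^+ 2)%R by lra.
rewrite integral_normal_exp_quad//; last by lra.
rewrite lee_fin expRD ler_pM ?invr_ge0 ?expR_ge0 ?sqrtr_ge0//.
  by rewrite -mulrA; exact: inv_sqrt_le_expR.
rewrite ler_expR ler_pdivrMr; last by lra.
rewrite ler_peMr//; last by lra.
by rewrite mulr_ge0 ?sqr_ge0.
Qed.

Lemma integral_normal_expR s b : s != 0%R ->
  \int[normal_prob 0 s]_x (expR (b * x))%:E = (expR (b ^+ 2 * s ^+ 2 / 2))%:E.
Proof.
move=> s0; have := @integral_normal_exp_quad 0 b s s0.
rewrite mulr0 mul0r subr0 sqrtr1 invr1 mul1r mulr1 ltr01 => <-//.
by apply: eq_integral => x _; rewrite mul0r add0r.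
Qed.

Context (d : measure_display) (T : measurableType d) (P : probability T R).
Variables (X : T -> R) (s : R).
Hypotheses (mX : measurable_fun setT X)
  (lawX : forall B, measurable B -> P (X @^-1` B) = gauss_law s B).

Lemma measurable_preim B : measurable B -> measurable (X @^-1` B).
Proof. by move=> mB; rewrite -[X in measurable X]setTI; exact: mX. Qed.

Lemma integral_gauss_law (f : R -> R) :
  measurable_fun setT f -> (forall x, 0 <= f x)%R ->
  \int[P]_w (f (X w))%:E =
  if s == 0%R then (f 0%R)%:E else \int[normal_prob 0 s]_x (f x)%:E.
Proof.
move=> mf f0.
(* One transfer for an arbitrary measure covers both the Dirac and the normal branch of
   [gauss_law]. *)
have H d' (U : measurableType d') (nu : {measure set U -> \bar R}) (Z : U -> R) :
    measurable_fun setT Z ->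
    (forall B, measurable B -> gauss_law s B = nu (Z @^-1` B)) ->
    \int[P]_w (f (X w))%:E = \int[nu]_x (f (Z x))%:E.
  move=> mZ nuE; rewrite -[RHS]mule1.
  have mpre B : measurable B -> measurable (Z @^-1` B).
    by move=> mB; rewrite -[X in measurable X]setTI; exact: mZ.
  rewrite -(@ge0_integral_transfer _ _ _ _ _ P nu X (cst 1%R) Z)//.
    by apply: eq_integral => w _; rewrite mulr1.
  move=> B mB; rewrite mule1 [RHS](integral_indic nu measurableT (mpre _ mB)).
  rewrite setIT -nuE// -lawX// -[in RHS](setIT (X @^-1` B)).
  rewrite -integral_indic//; last exact: measurable_preim.
  by apply: eq_integral => w _; rewrite mulr1.
case: ifPn => s0.
  rewrite (H _ _ \d_(0%R : R) id)//; last by move=> B mB; rewrite /gauss_law s0.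
  by rewrite integral_dirac// ?diracT ?mul1e//; exact/measurable_EFinP.
by apply: (H _ _ (normal_prob 0 s) id) => // B mB; rewrite /gauss_law (negbTE s0).
Qed.

Lemma gauss_exp_quad_le a b : (a * s ^+ 2 <= 1 / 4)%R ->
  \int[P]_w (expR (a * X w ^+ 2 + b * X w))%:E <=
  (expR (a * s ^+ 2 + 4 * (a * s ^+ 2) ^+ 2 + b ^+ 2 * s ^+ 2))%:E.
Proof.
move=> as4; rewrite (integral_gauss_law (f := fun x => expR (a * x ^+ 2 + b * x))).
- case: eqP => [->|/eqP s0]; last exact: integral_normal_exp_quad_le.
  by rewrite !(expr0n, mulr0, addr0)/=.
- apply: measurableT_comp => //; apply: measurable_funD => //.
  by apply: measurable_funM.
- by move=> x; exact: expR_ge0.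
Qed.

Lemma gauss_expR b :
  \int[P]_w (expR (b * X w))%:E = (expR (b ^+ 2 * s ^+ 2 / 2))%:E.
Proof.
rewrite (integral_gauss_law (f := fun x => expR (b * x))).
- case: eqP => [->|/eqP s0]; last exact: integral_normal_expR.
  by rewrite !(expr0n, mulr0, mul0r)/=.
- by apply: measurableT_comp => //; apply: measurable_funM.
- by move=> x; exact: expR_ge0.
Qed.

(** The density is even and Lebesgue measure is invariant under reflection. This form of symmetry is
    what [cross_moment] uses to obtain mean zero. *)
Lemma gauss_sym (f : R -> R) : measurable_fun setT f -> (forall x, 0 <= f x)%R ->
  \int[P]_w (f (X w))%:E = \int[P]_w (f (- X w)%R)%:E.
Proof.
move=> mf f0.
have mfN : measurable_fun setT (fun x : R => f (- x)%R) by exact: measurableT_comp.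
rewrite (integral_gauss_law mf)// (integral_gauss_law mfN)// oppr0.
case: eqP => // /eqP s0; rewrite !integral_normal_prob//.
pose g x := (f x * normal_pdf 0 s x)%R.
have mg : measurable_fun setT g.
  by apply: measurable_funM => //; exact: measurable_normal_pdf.
have g0 x : (0 <= g x)%R by rewrite mulr_ge0 ?normal_pdf_ge0.
have mN : measurable_fun [set: R] (-%R : R -> R) by [].
pose gN (x : R) := g (- x)%R.
transitivity (\int[lebesgue_measure]_x (gN x)%:E); last first.
  apply: eq_integral => x _; rewrite /gN /g !normal_pdfE// /normal_fun.
  by rewrite !subr0 sqrrN.
rewrite -[RHS]mule1; symmetry.
rewrite -(@ge0_integral_transfer _ _ _ _ _ lebesgue_measure lebesgue_measure
  id (cst 1%R) (-%R))//.
  by apply: eq_integral => x _; rewrite mulr1.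
move=> B mB; rewrite mule1.
under eq_integral do rewrite mulr1.
rewrite integral_indic// setIT.
transitivity (@lebesgue_measure R ((-%R : R -> R) @^-1` B)).
  exact/esym/lebesgue_measureN.
have mNB : measurable ((-%R : R -> R) @^-1` B).
  by rewrite -[X in measurable X]setTI; exact: mN.
by have := integral_indic (@lebesgue_measure R) measurableT mNB; rewrite setIT => <-.
Qed.

(** The absolute value is dominated by [expR x + expR (- x)], whose mean is known. *)
Lemma gauss_abs_lty : \int[P]_w `|X w|%:E < +oo.
Proof.
apply: (@le_lt_trans _ _ (\int[P]_w (expR (1 * X w) + expR (-1 * X w))%:E)).
  apply: ge0_le_integral => //.
  - by apply/measurable_EFinP; exact: measurableT_comp.
  - by apply/measurable_EFinP/measurable_funD; apply: measurableT_comp => //; exact: measurable_funM.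
  - move=> w _; rewrite lee_fin mul1r mulN1r.
    have [x0|x0] := lerP 0 (X w).
      rewrite ger0_norm//; have := expR_ge1Dx (X w); have := expR_ge0 (- X w); lra.
    rewrite ltr0_norm//; have := expR_ge1Dx (- X w); have := expR_ge0 (X w); lra.
under eq_integral do rewrite EFinD.
rewrite ge0_integralD//.
- by rewrite !gauss_expR -EFinD ltry.
- by apply/measurable_EFinP; apply: measurableT_comp => //; exact: measurable_funM.
- by apply/measurable_EFinP; apply: measurableT_comp => //; exact: measurable_funM.
Qed.

End Gaussian.

(** * Exponential moments of squares of sub-Gaussian variables *)

Section QuadraticMgf.
Local Open Scope ereal_scope.
Context (R : realType) (d : measure_display) (T : measurableType d)
  (P : probability T R).

(* Gaussian linearization: [expR (lam * y ^+ 2)] is the average of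
   [expR (Num.sqrt (2 * lam) * g * y)] over a standard normal [g]. *)
Lemma subgaussian_exp_quad (F y : T -> R) (K s lam : R) :
  measurable_fun setT F -> (forall w, 0 <= F w)%R -> measurable_fun setT y ->
  (0 <= K)%R -> (0 <= lam)%R -> (lam * s ^+ 2 <= 1 / 4)%R ->
  (forall th, \int[P]_w (F w * expR (th * y w))%:E <=
     (K * expR (th ^+ 2 * s ^+ 2 / 2))%:E) ->
  forall th, \int[P]_w (F w * expR (th * y w + lam * y w ^+ 2))%:E <=
    (K * expR (th ^+ 2 * s ^+ 2 + (lam * s ^+ 2 + 4 * (lam * s ^+ 2) ^+ 2)))%:E.
Proof.
move=> mF F0 my K0 lam0 lams H th.
pose r := Num.sqrt (2 * lam).
have r2 : (r ^+ 2 = 2 * lam)%R by rewrite sqr_sqrtr// mulr_ge0.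
pose N := @normal_prob R 0 1.
pose f (z : T * measurableTypeR R) := (F z.1 * expR ((th + r * z.2) * y z.1))%R.
have mf : measurable_fun setT f.
  apply: measurable_funM; first exact: measurableT_comp.
  apply: measurableT_comp => //; apply: measurable_funM.
    by apply: measurable_funD => //; exact: measurable_funM.
  exact: measurableT_comp.
have f0 z : (0 <= f z)%R by rewrite mulr_ge0// expR_ge0.
have mfx w : measurable_fun setT (fun g => f (w, g)).
  by apply: measurableT_comp => //; exact: measurable_pair1.
have mfy g : measurable_fun setT (fun w => f (w, g)).
  by apply: measurableT_comp => //; exact: measurable_pair2.
have -> : \int[P]_w (F w * expR (th * y w + lam * y w ^+ 2))%:E =
    \int[P]_w \int[N]_g (f (w, g))%:E.
  apply: eq_integral => w _.
  transitivity ((F w * expR (th * y w))%:E *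
      \int[N]_g (expR (r * y w * g))%:E).
    rewrite integral_normal_expR ?oner_neq0// -EFinM -[X in _ = X%:E]mulrA -expRD.
    by rewrite exprMn r2 expr1n; congr (_ * expR _)%:E; field.
  rewrite -ge0_integralZl_real//.
  - apply: eq_integral => g _; congr EFin; rewrite /f/= -[LHS]mulrA -expRD.
    by congr (_ * expR _)%R; ring.
  - by rewrite mulr_ge0 ?expR_ge0.
  - by apply: measurableT_comp => //; exact: measurable_funM.
(* After the exchange, the hypothesis applies for each fixed [g] with parameter [th + r * g]; what
   remains is a standard normal integral of an exponential quadratic in [g]. *)
rewrite (fubini_tonelli (m1 := P) (m2 := N) (fun z => (f z)%:E)); last 2 first.
- exact/measurable_EFinP.
- by move=> z; rewrite lee_fin.
apply: (@le_trans _ _ (\int[N]_g (K * expR (th ^+ 2 * s ^+ 2 / 2) *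
    expR (lam * s ^+ 2 * g ^+ 2 + th * r * s ^+ 2 * g))%:E)).
  apply: ge0_le_integral => //.
  - by move=> g _; apply: integral_ge0 => w _; rewrite lee_fin.
  - apply: (measurable_fun_fubini_tonelli_G (m1 := P) (fun z => (f z)%:E)).
      exact/measurable_EFinP.
    by move=> z; rewrite lee_fin.
  - apply/measurable_EFinP; apply: measurable_funM => //.
    apply: measurableT_comp => //; apply: measurable_funD; exact: measurable_funM.
  - move=> g _; apply: (le_trans (H (th + r * g)%R)); rewrite lee_fin -[leRHS]mulrA -expRD.
    rewrite ler_wpM2l// ler_expR.
    have -> : (lam = r ^+ 2 / 2)%R by rewrite r2; field.
    by rewrite le_eqVlt; apply/orP; left; apply/eqP; field.
rewrite ge0_integralZl_real; last 3 first.
- by rewrite mulr_ge0 ?expR_ge0.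
- apply: measurableT_comp => //; apply: measurable_funD; exact: measurable_funM.
- by move=> g; exact: expR_ge0.
have := @integral_normal_exp_quad_le R (lam * s ^+ 2) (th * r * s ^+ 2) 1
  (oner_neq0 _).
rewrite expr1n !mulr1 => /(_ lams) le1.
apply: (le_trans (lee_wpmul2l _ le1)).
  by rewrite lee_fin mulr_ge0 ?expR_ge0.
rewrite -EFinM lee_fin -[leLHS]mulrA ler_wpM2l// -expRD ler_expR.
rewrite !exprMn r2.
(* The cross term is at most half of [th ^+ 2 * s ^+ 2], since [lam * s ^+ 2 <= 1 / 4]; it uses up
   the factor 1/2 of the hypothesis. *)
have -> : (th ^+ 2 * (2 * lam) * (s ^+ 2) ^+ 2 = 2 * (lam * s ^+ 2) * (th ^+ 2 * s ^+ 2))%R by ring.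
have u0 : (0 <= th ^+ 2 * s ^+ 2)%R by rewrite mulr_ge0 ?sqr_ge0.
have := ler_wpM2r u0 lams.
lra.
Qed.

(** Squares are inserted one coordinate at a time: the factors of the other coordinates form the
    weight [F], and the joint bound, read as a function of [th i0] alone, is the hypothesis of
    [subgaussian_exp_quad]. *)
Lemma subgaussian_family_exp_quad (I : finType) (y : I -> T -> R) (s : I -> R)
  (lam : R) :
  (forall i, measurable_fun setT (y i)) ->
  (0 <= lam)%R -> (forall i, lam * s i ^+ 2 <= 1 / 4)%R ->
  (forall th : I -> R, \int[P]_w (expR (\sum_i th i * y i w))%:E <=
     (expR (\sum_i th i ^+ 2 * s i ^+ 2 / 2))%:E) ->
  forall th : I -> R,
    \int[P]_w (expR (\sum_i (th i * y i w + lam * y i w ^+ 2)))%:E <=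
    (expR (\sum_i (th i ^+ 2 * s i ^+ 2 +
       (lam * s i ^+ 2 + 4 * (lam * s i ^+ 2) ^+ 2))))%:E.
Proof.
move=> my lam0 lams H.
pose q i : R := (lam * s i ^+ 2 + 4 * (lam * s i ^+ 2) ^+ 2)%R.
(* [S] lists the coordinates whose square is already present; only those pay [q i] and lose the
   factor 1/2. *)
have main (S : seq I) : uniq S -> forall th : I -> R,
    \int[P]_w (expR (\sum_i (th i * y i w +
        (if i \in S then lam * y i w ^+ 2 else 0))))%:E <=
    (expR (\sum_i (if i \in S then th i ^+ 2 * s i ^+ 2 + q i
                   else th i ^+ 2 * s i ^+ 2 / 2)))%:E.
  elim: S => [_ th|i0 S IH /= /andP[i0S uS] th].
    have := H th; congr (_ <= _); apply: eq_integral => w _.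
    by congr (expR _)%:E; apply: eq_bigr => i _; rewrite in_nil addr0.
  pose F w := expR (\sum_(i | i != i0) (th i * y i w +
        (if i \in S then lam * y i w ^+ 2 else 0)))%R.
  pose K := expR (\sum_(i | i != i0) (if i \in S then th i ^+ 2 * s i ^+ 2 + q i
                   else th i ^+ 2 * s i ^+ 2 / 2))%R.
  have mF : measurable_fun setT F.
    apply: measurableT_comp => //; apply: measurable_fun_sum => i.
    apply: measurable_funD; first exact: measurable_funM.
    by case: (i \in S) => //; apply: measurable_funM => //; exact: measurable_funX.
  have HF th' : \int[P]_w (F w * expR (th' * y i0 w))%:E <=
     (K * expR (th' ^+ 2 * s i0 ^+ 2 / 2))%:E.
    have := IH uS (fun i => if i == i0 then th' else th i).
    rewrite (bigD1 i0)//= eqxx (negbTE i0S) expRD mulrC.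
    rewrite (eq_bigr (fun i => if i \in S then th i ^+ 2 * s i ^+ 2 + q i
                   else th i ^+ 2 * s i ^+ 2 / 2)%R); last first.
      by move=> i /negbTE ->.
    congr (_ <= _); apply: eq_integral => w _.
    rewrite (bigD1 i0)//= eqxx (negbTE i0S) addr0 expRD mulrC.
    by congr (expR _ * _)%:E; apply: eq_bigr => i /negbTE ->.
  have sumE (f g : I -> R) : (\sum_i (if i \in i0 :: S then f i else g i) =
      f i0 + \sum_(i | i != i0) (if i \in S then f i else g i))%R.
    rewrite (bigD1 i0)//= mem_head; congr (_ + _)%R.
    by apply: eq_bigr => i /negbTE ii0; rewrite in_cons ii0.
  rewrite sumE expRD mulrC -/K.
  apply: le_trans (subgaussian_exp_quad mF (fun w => expR_ge0 _) (my i0)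
    (expR_ge0 _) lam0 (lams i0) HF (th i0)).
  rewrite le_eqVlt; apply/orP; left; apply/eqP; apply: eq_integral => w _.
  rewrite (bigD1 i0)//= mem_head expRD mulrC /F.
  congr (expR _ * _)%:E; apply: eq_bigr => i /negbTE ii0.
  by rewrite in_cons ii0.
move=> th; have := main _ (enum_uniq I) th.
under eq_integral do under eq_bigr do rewrite mem_enum.
by under [X in _ <= (expR X)%:E -> _]eq_bigr do rewrite mem_enum.
Qed.

End QuadraticMgf.

(** * Mean zero for products of independent symmetric variables *)

Section CrossMoment.
Local Open Scope ereal_scope.
Context (R : realType) (d : measure_display) (T : measurableType d)
  (P : probability T R) (I : finType) (X : I -> T -> R).
Hypotheses (mX : forall i, measurable_fun setT (X i))
  (indX : mutually_independent P X).

Lemma integral_pair_indep (a b : I) (f g : R -> R) : a != b ->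
  measurable_fun setT f -> (forall x, 0 <= f x)%R ->
  measurable_fun setT g -> (forall x, 0 <= g x)%R ->
  \int[P]_w (f (X a w))%:E < +oo -> \int[P]_w (g (X b w))%:E < +oo ->
  \int[P]_w (f (X a w) * g (X b w))%:E =
  \int[P]_w (f (X a w))%:E * \int[P]_w (g (X b w))%:E.
Proof.
move=> ab mf f0 mg g0 ffin gfin.
pose h i := if i == a then f else if i == b then g else cst 1%R.
have ba : (b == a) = false by rewrite eq_sym (negbTE ab).
have ha : h a = f by rewrite /h eqxx.
have hb : h b = g by rewrite /h ba eqxx.
have h1 i : i != a -> i != b -> h i = cst 1%R.
  by rewrite /h => /negbTE -> /negbTE ->.
have I1 : \int[P]_w (cst 1%R w : R)%:E = 1.
  transitivity (\int[P]_w (cst 1 w)); first exact: eq_integral.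
  by rewrite integral_cst//= probability_setT mul1e.
have := @integral_prod_indep _ _ _ P I X h mX indX.
have -> : \prod_i \int[P]_w (h i (X i w))%:E =
    \int[P]_w (f (X a w))%:E * \int[P]_w (g (X b w))%:E.
  rewrite (bigD1 a)//= (bigD1 b)/= ?ba// ha hb big1 ?mule1// => i /andP[ia ib].
  by under eq_integral do rewrite h1//.
move=> <-.
- apply: eq_integral => w _.
  rewrite (bigD1 a)//= (bigD1 b)/= ?ba// ha hb big1 ?mulr1// => i /andP[ia ib].
  by rewrite h1.
- by move=> i; rewrite /h; do 2?case: ifP => // _; exact: measurable_cst.
- by move=> i x; rewrite /h; do 2?case: ifP => // _; exact: ler01.
- move=> i; have [->|ia] := eqVneq i a; first by rewrite ha.
  have [->|ib] := eqVneq i b; first by rewrite hb.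
  by under eq_integral do rewrite h1//; rewrite I1 ltry.
Qed.

(** The product formula holds for nonnegative functions, so [X a] and [X b] are split into positive
    and negative parts. By symmetry both parts of [X b] have the same mean, hence the positive and
    negative parts of the product have equal finite integrals. *)
Lemma cross_moment (a b : I) : a != b ->
  \int[P]_w `|X a w|%:E < +oo -> \int[P]_w `|X b w|%:E < +oo ->
  (forall f : R -> R, measurable_fun setT f -> (forall x, 0 <= f x)%R ->
     \int[P]_w (f (X b w))%:E = \int[P]_w (f (- X b w)%R)%:E) ->
  P.-integrable setT (fun w => (X a w * X b w)%:E) /\
  \int[P]_w (X a w * X b w)%:E = 0.
Proof.
move=> ab afin bfin symb.
pose ps (x : R) := Num.max 0%R x; pose ng (x : R) := Num.max 0%R (- x)%R.
have mps : measurable_fun setT ps by exact: measurable_maxr.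
have mng : measurable_fun setT ng by apply: measurable_maxr.
have ps0 x : (0 <= ps x)%R by rewrite le_max lexx.
have ng0 x : (0 <= ng x)%R by rewrite le_max lexx.
have mnorm : measurable_fun setT (fun x : R => `|x|%R) by [].
have fin i (f : R -> R) : (forall x, 0 <= f x)%R -> measurable_fun setT f ->
    (forall x, f x <= `|x|)%R ->
    \int[P]_w `|X i w|%:E < +oo -> \int[P]_w (f (X i w))%:E < +oo.
  move=> f0 mf fle; apply: le_lt_trans; apply: ge0_le_integral => //.
  - by move=> w _; rewrite lee_fin.
  - by apply/measurable_EFinP; exact: measurableT_comp.
  - by apply/measurable_EFinP; exact: measurableT_comp.
  - by move=> w _; rewrite lee_fin.
have psle x : (ps x <= `|x|)%R by rewrite ge_max normr_ge0 ler_norm.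
have ngle x : (ng x <= `|x|)%R by rewrite ge_max normr_ge0 -normrN ler_norm.
have int : P.-integrable setT (fun w => (X a w * X b w)%:E).
  apply/integrableP; split; first by apply/measurable_EFinP/measurable_funM.
  under eq_integral do rewrite /= normrM.
  rewrite (integral_pair_indep (f := Num.norm) (g := Num.norm))//.
  rewrite lte_mul_pinfty//; first by apply: integral_ge0 => w _; rewrite lee_fin.
  by rewrite ge0_fin_numE//; apply: integral_ge0 => w _; rewrite lee_fin.
split=> //.
(* Symmetry replaces [ng (X b)] by [ps (X b)] on the right. Used with [(ps, ng)] and [(ng, ps)], it
   gives the same two terms in opposite order. *)
have E1 (f g : R -> R) : (forall x, 0 <= f x)%R -> measurable_fun setT f ->
    (forall x, f x <= `|x|)%R -> (forall x, 0 <= g x)%R -> measurable_fun setT g ->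
    (forall x, g x <= `|x|)%R ->
    \int[P]_w (f (X a w) * ps (X b w) + g (X a w) * ng (X b w))%:E =
    \int[P]_w (f (X a w))%:E * \int[P]_w (ps (X b w))%:E +
    \int[P]_w (g (X a w))%:E * \int[P]_w (ps (X b w))%:E.
  move=> f0 mf fle g0 mg gle; under eq_integral do rewrite EFinD.
  rewrite ge0_integralD//.
  - rewrite !integral_pair_indep//; try by apply: fin.
    by congr (_ + _ * _); rewrite [RHS]symb.
  - by move=> w _; rewrite lee_fin mulr_ge0.
  - by apply/measurable_EFinP/measurable_funM; exact: measurableT_comp.
  - by move=> w _; rewrite lee_fin mulr_ge0.
  - by apply/measurable_EFinP/measurable_funM; exact: measurableT_comp.
have pos x : (0 <= x)%R -> ps x = x /\ ng x = 0%R.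
  by move=> x0; rewrite /ps /ng max_r// max_l// oppr_le0.
have neg x : (x < 0)%R -> ps x = 0%R /\ ng x = (- x)%R.
  by move=> /ltW x0; rewrite /ps /ng max_l// max_r// oppr_ge0.
have maxM (x y : R) : Num.max (x * y)%R 0%R = (ps x * ps y + ng x * ng y)%R.
  have [/[dup] x0 /pos[-> ->]|/[dup] /ltW x0 /neg[-> ->]] := lerP 0%R x;
  have [/[dup] y0 /pos[-> ->]|/[dup] /ltW y0 /neg[-> ->]] := lerP 0%R y;
  rewrite ?(mul0r, mulr0, addr0, add0r, mulrNN).
  - by rewrite max_l// mulr_ge0.
  - by rewrite max_r// mulr_ge0_le0.
  - by rewrite max_r// mulr_le0_ge0.
  - by rewrite max_l// mulr_le0.
have maxMN (x y : R) : Num.max (- (x * y))%R 0%R = (ng x * ps y + ps x * ng y)%R.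
  rewrite -mulNr maxM; congr (_ * _ + _ * _)%R; rewrite /ps /ng ?opprK//.
rewrite integralE.
have -> : \int[P]_w ((fun w => (X a w * X b w)%:E)^\+ w) =
    \int[P]_w (ps (X a w) * ps (X b w) + ng (X a w) * ng (X b w))%:E.
  apply: eq_integral => w _; rewrite funeposE -EFin_max; congr EFin; exact: maxM.
have -> : \int[P]_w ((fun w => (X a w * X b w)%:E)^\- w) =
    \int[P]_w (ng (X a w) * ps (X b w) + ps (X a w) * ng (X b w))%:E.
  apply: eq_integral => w _; rewrite funenegE -EFinN -EFin_max; congr EFin; exact: maxMN.
have finE i (f : R -> R) : (forall x, 0 <= f x)%R -> measurable_fun setT f ->
    (forall x, f x <= `|x|)%R -> \int[P]_w `|X i w|%:E < +oo ->
    \int[P]_w (f (X i w))%:E \is a fin_num.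
  move=> f0 mf fle ifin; rewrite ge0_fin_numE; first exact: fin.
  by apply: integral_ge0 => w _; rewrite lee_fin.
have pa := finE a ps ps0 mps psle afin; have na := finE a ng ng0 mng ngle afin.
have pb := finE b ps ps0 mps psle bfin.
rewrite (E1 ps ng ps0 mps psle ng0 mng ngle) (E1 ng ps ng0 mng ngle ps0 mps psle).
by rewrite [X in _ - X]addeC subee// fin_numD !fin_numM.
Qed.

End CrossMoment.

(** * Rayleigh quotients *)

Section Rayleigh.
Context (R : realType) (n : nat).
Implicit Types (A B : 'M[R]_n) (u v x y : 'rV[R]_n).

Definition bform B x y : R := (x *m B *m y^T) 0 0.

Lemma bformDl B x x' y : bform B (x + x') y = bform B x y + bform B x' y.
Proof. by rewrite /bform !mulmxDl mxE. Qed.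

Lemma bformZl B t x y : bform B (t *: x) y = t * bform B x y.
Proof. by rewrite /bform -!scalemxAl mxE. Qed.

Lemma bformC B x y : B^T = B -> bform B x y = bform B y x.
Proof.
move=> BT; rewrite /bform; transitivity ((x *m B *m y^T)^T 0 0).
  by rewrite [RHS]mxE.
by rewrite !trmx_mul BT trmxK mulmxA.
Qed.

Lemma dotE x y : (x *m y^T) 0 0 = \sum_j x 0 j * y 0 j.
Proof. by rewrite mxE; apply: eq_bigr => j _; rewrite mxE. Qed.

(** Along the line [x + t *: (x *m B)] the form is a nonnegative polynomial in [t] without constant
    term, so its linear coefficient, a multiple of the squared norm of [x *m B], vanishes. *)
Lemma psd_ker B x : B^T = B -> (forall y, 0 <= bform B y y) ->
  bform B x x = 0 -> x *m B = 0.
Proof.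
move=> BT psd x0.
pose y := x *m B; pose g := bform B y y; pose b := bform B x y.
have g0 : 0 <= g by exact: psd.
have quad t : 0 <= 2 * t * b + t ^+ 2 * g.
  have := psd (x + t *: y).
  rewrite bformDl [bform B x _]bformC// bformDl bformZl bformZl [bform B y (_ + _)]bformC//.
  rewrite bformDl bformZl x0 [bform B y x]bformC// -/b -/g.
  by congr (0 <= _); ring.
have b0 : b = 0.
  (* Nearly the minimizer [- b / g]; the added 1 keeps the denominator positive when [g = 0]. *)
  have := quad (- b / (g + 1)).
  have g1 : 0 < g + 1 by lra.
  have -> : 2 * (- b / (g + 1)) * b + (- b / (g + 1)) ^+ 2 * g =
      - (b / (g + 1)) ^+ 2 * (g + 2).
    by field; rewrite gt_eqF.
  rewrite mulNr oppr_ge0 => le0.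
  have : (b / (g + 1)) ^+ 2 <= 0.
    rewrite leNgt; apply/negP => h; have := mulr_gt0 h (_ : 0 < g + 2); lra.
  rewrite le_eqVlt ltNge sqr_ge0 orbF sqrf_eq0 mulf_eq0 invr_eq0 (gt_eqF g1) orbF.
  by move/eqP.
have : \sum_j y 0 j ^+ 2 = 0.
  by rewrite -[RHS]b0 /b /bform -/y dotE.
move=> /psumr_eq0P H; apply/rowP => j; rewrite !mxE.
by have /eqP := H (fun j _ => sqr_ge0 _) j isT; rewrite sqrf_eq0 => /eqP; rewrite mxE.
Qed.

Lemma continuous_bform A : continuous (fun x : 'rV[R]_n => bform A x x).
Proof.
have -> : (fun x : 'rV[R]_n => bform A x x) =
    (fun x => \sum_j \sum_k x 0 k * A k j * x 0 j).
  apply/funext => x; rewrite /bform mxE; apply: eq_bigr => j _.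
  by rewrite !mxE mulr_suml.
apply: continuous_big => [|j _]; first exact: add_continuous.
apply: continuous_big => [|k _ x]; first exact: add_continuous.
have FF : Filter (nbhs x) by exact: nbhs_filter.
have cc i := @coord_continuous R 1 n 0 i x.
exact: (@cvgM _ _ _ FF (fun y : 'rV[R]_n => y 0 k * A k j) _ _ _
  (@cvgM _ _ _ FF _ (fun=> A k j) _ _ (cc k) (@cvg_cst _ _ _ _ FF)) (cc j)).
Qed.

Lemma bform1 x : bform 1%:M x x = \sum_j x 0 j ^+ 2.
Proof. by rewrite /bform mulmx1 dotE; apply: eq_bigr => j _; rewrite expr2. Qed.

(** A maximizer [c] on the compact unit sphere exists. With [m] its value, [m%:M - A] is positive
    semidefinite and its form vanishes at [c], so [psd_ker] makes [c] an eigenvector. *)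
Lemma rayleigh_max A : (0 < n)%N -> A^T = A ->
  exists m, eigenvalue A m /\
    forall u, \sum_j u 0 j ^+ 2 = 1 -> bform A u u <= m.
Proof.
move=> n0 AT.
pose S := [set u : 'rV[R]_n | \sum_j u 0 j ^+ 2 = 1].
have Sne : S !=set0.
  exists (delta_mx 0 (Ordinal n0)); rewrite /S/= (bigD1 (Ordinal n0))//= mxE !eqxx.
  rewrite expr1n big1 ?addr0// => j jn; rewrite mxE (negbTE jn) andbF expr0n//.
have Scl : closed S.
  have -> : S = (fun u => bform 1%:M u u) @^-1` [set 1].
    by apply/seteqP; split=> u /=; rewrite bform1.
  have /continuous_closedP := continuous_bform (A := 1%:M); apply.
  exact: closed_eq.
have Sbd : bounded_set S.
  exists 1; split=> // M M1 u Su.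
  rewrite /= [leLHS]/Num.Def.normr/= mx_normrE; apply: bigmax_le => [|[i j] _].
    by rewrite ltW// (lt_trans ltr01).
  rewrite (le_trans _ (ltW M1))//= ord1 -(@ler_pXn2r _ 2) ?nnegrE// real_normK ?num_real//.
  rewrite expr1n -Su (bigD1 j)//= lerDl; apply: sumr_ge0 => k _; exact: sqr_ge0.
have [c cS cmax] := @EVT_max_rV R n (fun u => bform A u u) S Sne
  (bounded_closed_compact Sbd Scl)
  (continuous_subspaceT (continuous_bform (A := A))).
pose m := bform A c c; exists m.
have c1 : \sum_j c 0 j ^+ 2 = 1 by move/set_mem : cS.
have mA u : \sum_j u 0 j ^+ 2 = 1 -> bform A u u <= m.
  by move=> u1; apply: cmax; exact/mem_set.
split=> //.
pose B := m%:M - A.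
have BE x : bform B x x = m * (\sum_j x 0 j ^+ 2) - bform A x x.
  rewrite /bform /B mulmxBr mulmxBl mul_mx_scalar -scalemxAl [LHS]mxE.
  rewrite [X in X + _ = _]mxE [X in _ + X = _]mxE [in LHS](dotE x x).
  by congr (_ * _ - _); apply: eq_bigr => j _; rewrite expr2.
have BT : B^T = B by rewrite /B linearB/= tr_scalar_mx AT.
have psd y : 0 <= bform B y y.
  have N0 : 0 <= \sum_j y 0 j ^+ 2 by apply: sumr_ge0 => j _; exact: sqr_ge0.
  have [N0'|Nn0] := eqVneq (\sum_j y 0 j ^+ 2) 0.
    have -> : y = 0.
      apply/rowP => j; rewrite mxE; apply/eqP; rewrite -sqrf_eq0; apply/eqP.
      exact: (psumr_eq0P (fun k _ => sqr_ge0 (y 0 k)) N0').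
    by rewrite /bform trmx0 mulmx0 mxE.
  pose r := Num.sqrt (\sum_j y 0 j ^+ 2).
  have r2 : r ^+ 2 = \sum_j y 0 j ^+ 2 by rewrite sqr_sqrtr.
  have rn0 : r != 0 by rewrite -sqrf_eq0 r2.
  have := mA (r^-1 *: y).
  have -> : \sum_j (r^-1 *: y) 0 j ^+ 2 = 1.
    under eq_bigr do rewrite mxE exprMn.
    by rewrite -mulr_sumr -r2 -exprMn mulVf// expr1n.
  rewrite bformZl bformC// bformZl BE -r2 => /(_ erefl) le1.
  have r20 : 0 < r ^+ 2 by rewrite r2 lt_def Nn0.
  rewrite subr_ge0; have := ler_wpM2r (ltW r20) le1; congr (_ <= _).
  by field.
have := @psd_ker B c BT psd; rewrite BE c1 mulr1 subrr => /(_ erefl) cB.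
apply/eigenvalueP; exists c.
  by move: cB; rewrite mulmxBr mul_mx_scalar => /eqP; rewrite subr_eq0 => /eqP.
apply/eqP => c0; move: c1; rewrite c0 big1 => [/eqP|j _]; last by rewrite mxE expr0n.
by rewrite eq_sym oner_eq0.
Qed.

(** [unit_leading_eigvec] compares eigenvalues only; since the maximum of the Rayleigh quotient is
    an eigenvalue, [v] attains it. *)
Lemma leading_eigvec_max A v u : A^T = A -> unit_leading_eigvec A v ->
  \sum_j u 0 j ^+ 2 = 1 -> bform A u u <= bform A v v.
Proof.
move=> AT [v1 [a [vA amax]]] u1.
have n0 : (0 < n)%N.
  case: (posnP n) => // n0; exfalso; move: v1; rewrite big1.
    by move/eqP; rewrite eq_sym oner_eq0.
  by move=> j _; have := ltn_ord j; move: (nat_of_ord j) => k; rewrite {1}n0.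
have [m [meig mmax]] := rayleigh_max n0 AT.
apply: le_trans (mmax u u1) _; apply: le_trans (amax m meig) _.
by rewrite /bform vA -scalemxAl mxE dotE v1 mulr1.
Qed.
End Rayleigh.

(** * Misclassification and overlap *)

Section Misclass.
Context (R : realType) (n : nat).
Implicit Types (l v : 'I_n -> R).

(** At an error [a * b <= 0], so [k * b] lies at distance at least 1 from [a]. The value [b = 0] has
    sign 0 and counts as an error. *)
Lemma sg_neq_le (a b : R) (k : R) : a = 1 \/ a = -1 -> 0 <= k ->
  (a != Num.sg b)%:R <= (k * b - a) ^+ 2.
Proof.
move=> ha k0; have [_|ab] := eqVneq a (Num.sg b); first by rewrite sqr_ge0.
have a2 : a ^+ 2 = 1 by case: ha => ->; rewrite ?sqrrN expr1n.
have abs : a * b <= 0.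
  rewrite leNgt; apply: contra ab => ab0; apply/eqP.
  move: ab0; case: ha => ->; rewrite ?mul1r ?mulN1r ?oppr_gt0 => b0.
    by rewrite gtr0_sg.
  by rewrite ltr0_sg.
have -> : (k * b - a) ^+ 2 = (k * b) ^+ 2 - 2 * k * (a * b) + a ^+ 2 by ring.
have := mulr_ge0_le0 k0 abs; have := sqr_ge0 (k * b); rewrite a2 /=; lra.
Qed.

Lemma misclass_le1 (l lh : 'I_n -> R) : misclass l lh <= 1.
Proof.
rewrite /misclass; have [->|n0] := eqVneq n%:R (0 : R); first by rewrite invr0 mul0r.
have n_gt0 : (0 : R) < n%:R by rewrite lt_def n0 ler0n.
rewrite mulrC ler_pdivrMr// mul1r ge_min; apply/orP; left.
rewrite (le_trans (y := \sum_(j < n) 1))//.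
  by apply: ler_sum => j _; case: (_ != _).
by rewrite sumr_const card_ord.
Qed.

(** The two error counts are at most the squared distances from [r * v] and [- r * v] to [l], that
    is [2 * (n%:R - r * c)] and [2 * (n%:R + r * c)]. The smaller is bounded through
    [c ^+ 2 <= r * |c|]. *)
Lemma misclass_le_overlap l v : (0 < n)%N -> (forall j, l j = 1 \/ l j = -1) ->
  \sum_j v j ^+ 2 = 1 ->
  n%:R * misclass l (fun j => Num.sg (v j)) <= 2 * (n%:R - (\sum_j v j * l j) ^+ 2).
Proof.
move=> n0 hl v1; set r := Num.sqrt (n%:R : R); set c := \sum_j v j * l j.
have n0' : (0 : R) < n%:R by rewrite ltr0n.
have r0 : 0 < r by rewrite sqrtr_gt0.
have r2 : r ^+ 2 = n%:R by rewrite sqr_sqrtr.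
have l2 j : l j ^+ 2 = 1 by case: (hl j) => ->; rewrite ?sqrrN expr1n.
have sumE (k : R) : \sum_j (k * v j - l j) ^+ 2 = k ^+ 2 - 2 * k * c + n%:R.
  transitivity (\sum_j (k ^+ 2 * v j ^+ 2 - 2 * k * (v j * l j) + 1)).
    by apply: eq_bigr => j _; have := l2 j; lra.
  by rewrite !big_split/= sumrN -!mulr_sumr v1 mulr1 sumr_const card_ord.
have sumP : \sum_j ((l j != Num.sg (v j))%:R : R) <= 2 * (n%:R - r * c).
  apply: (le_trans (ler_sum _ (fun j _ => sg_neq_le (v j) (hl j) (ltW r0)))).
  by rewrite sumE r2; lra.
have sumN : \sum_j ((l j != - Num.sg (v j))%:R : R) <= 2 * (n%:R + r * c).
  have H j : (l j != - Num.sg (v j))%:R <= (- r * v j - l j) ^+ 2.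
    rewrite -sgrN; apply: le_trans (sg_neq_le (- v j) (hl j) (ltW r0)) _.
    by rewrite mulrN mulNr.
  apply: (le_trans (ler_sum _ (fun j _ => H j))).
  by rewrite sumE sqrrN r2; lra.
rewrite /misclass mulrA mulfV ?gt_eqF// mul1r.
(* Cauchy-Schwarz: at [k = c] the sum of squares [sumE] equals [n%:R - c ^+ 2]. *)
have c2 : c ^+ 2 <= n%:R.
  have : 0 <= \sum_j (c * v j - l j) ^+ 2 by apply: sumr_ge0 => j _; exact: sqr_ge0.
  by rewrite sumE; lra.
have cr : `|c| <= r.
  by rewrite -(@ler_pXn2r _ 2) ?nnegrE ?(ltW r0)// real_normK ?num_real// r2.
have {}c2 : c ^+ 2 <= r * `|c|.
  by rewrite -real_normK ?num_real// expr2 ler_wpM2r.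
rewrite ge_min; apply/orP.
have [c0|c0] := lerP 0 c.
  by left; move: c2; rewrite ger0_norm//; lra.
by right; move: c2; rewrite ltr0_norm//; lra.
Qed.

End Misclass.

(** * Lattice rounding and counting *)

Section Rounding.
Context (R : realType).

(* Sign and magnitude; 0 has two codes, which only enlarges the net. *)
Definition lattice_val (N : nat) (k : bool * 'I_N) : R := (-1) ^+ k.1 * (k.2 : nat)%:R.

(** The magnitudes [m] and [m.+1] around [|r|] move [r] in opposite directions, so one of them
    agrees with the sign of [g]. The margin 1 makes [m.+1] a valid index. *)
Lemma lattice_round (N : nat) (r g : R) : `|r| + 1 < N%:R ->
  exists k : bool * 'I_N, `|lattice_val k - r| <= 1 /\ 0 <= (lattice_val k - r) * g.
Proof.
move=> rN; pose m := Num.truncn `|r|.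
have /andP[mr rm] : m%:R <= `|r| < m.+1%:R by exact/truncn_itv.
pose s := (-1) ^+ (r < 0)%R : R.
have rE : r = s * `|r|.
  rewrite /s; case: ltrP => [/ltr0_norm|/ger0_norm] ->;
    by rewrite ?expr1 ?expr0 ?mul1r// mulN1r opprK.
have s2 : `|s| = 1 by rewrite normr_sign.
have mN : (m.+1 < N)%N.
  by rewrite -(ltr_nat R) (le_lt_trans _ rN)// -natr1 lerD2r.
have [sg0|sg0] := lerP 0 (s * g).
  exists ((r < 0)%R, Ordinal mN); rewrite /lattice_val/= -/s.
  have -> : s * m.+1%:R - r = s * (m.+1%:R - `|r|) by rewrite {1}rE; ring.
  have d0 : 0 <= m.+1%:R - `|r| by rewrite subr_ge0 ltW.
  rewrite normrM s2 mul1r ger0_norm//; split; first by rewrite -natr1; lra.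
  by rewrite mulrAC mulr_ge0.
exists ((r < 0)%R, Ordinal (ltnW mN)); rewrite /lattice_val/= -/s.
have -> : s * m%:R - r = s * (m%:R - `|r|) by rewrite {1}rE; ring.
have d0 : m%:R - `|r| <= 0 by rewrite subr_le0.
rewrite normrM s2 mul1r ler0_norm//; split; first by rewrite -natr1 in rm; lra.
by rewrite mulrAC mulr_le0// ltW.
Qed.

Definition update (n : nat) (x : 'I_n -> R) (j : 'I_n) (t : R) : 'I_n -> R :=
  fun k => x k + (k == j)%:R * t.

(* Moving one coordinate at a time in the direction in which the linear part of
   [Q] does not decrease, only the diagonal second-order terms are lost. *)
Lemma greedy_rounding (n N : nat) (Q : ('I_n -> R) -> R) (D : 'I_n -> R)
  (L : ('I_n -> R) -> 'I_n -> R) (h : R) (x : 'I_n -> R) :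
  (forall y j t, Q (update y j t) = Q y + t * L y j + t ^+ 2 * D j) ->
  (0 < N)%N -> 0 < h -> (forall j, `|x j / h| + 1 < N%:R) ->
  exists k : {ffun 'I_n -> bool * 'I_N},
    (forall j, `|h * lattice_val (k j) - x j| <= h) /\
    Q x <= Q (fun j => h * lattice_val (k j)) + h ^+ 2 * \sum_j Num.max 0 (- D j).
Proof.
move=> HQ N0 h0 xN.
have main (S : seq 'I_n) : uniq S -> exists k : {ffun 'I_n -> bool * 'I_N},
    (forall j, j \in S -> `|h * lattice_val (k j) - x j| <= h) /\
    Q x <= Q (fun j => if j \in S then h * lattice_val (k j) else x j) +
      h ^+ 2 * \sum_(j <- S) Num.max 0 (- D j).
  elim: S => [_|j0 S IH /= /andP[j0S uS]].
    exists [ffun=> (true, Ordinal N0)]; split=> //.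
    by rewrite big_nil mulr0 addr0.
  have [k [kx Qk]] := IH uS.
  set y := (fun j => _) in Qk.
  (* The direction is chosen from the linear part at the partially rounded point [y], not at the
     original [x]. *)
  have [k0 [k0x k0g]] := lattice_round (L y j0) (xN j0).
  exists [ffun j => if j == j0 then k0 else k j]; split.
    move=> j; rewrite in_cons ffunE; have [->|jj] := eqVneq j j0; last exact: kx.
    move=> _; have -> : h * lattice_val k0 - x j0 = h * (lattice_val k0 - x j0 / h).
      by field; rewrite gt_eqF.
    by rewrite normrM gtr0_norm// -[leRHS]mulr1 ler_wpM2l// ltW.
  pose t := h * (lattice_val k0 - x j0 / h).
  have -> : (fun j => if j \in j0 :: S
      then h * lattice_val ([ffun j => if j == j0 then k0 else k j] j)
      else x j) = update y j0 t.
    apply/funext => j; rewrite in_cons ffunE /update /y.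
    have [->|jj] := eqVneq j j0; last by rewrite mul0r addr0.
    rewrite /= (negbTE j0S) mul1r /t; field; by rewrite gt_eqF.
  rewrite HQ big_cons.
  have tL : 0 <= t * L y j0 by rewrite /t -mulrA mulr_ge0// ltW.
  have th : t ^+ 2 <= h ^+ 2.
    rewrite -[leLHS]real_normK ?num_real// ler_pXn2r ?nnegrE ?(ltW h0)//.
    by rewrite /t normrM gtr0_norm// -[leRHS]mulr1 ler_wpM2l// ltW.
  (* As [|t| <= h], the second-order term loses at most [h ^+ 2] times the negative part of
     [D j0]. *)
  have tD : 0 <= t ^+ 2 * D j0 + h ^+ 2 * Num.max 0 (- D j0).
    have m0 : 0 <= Num.max 0 (- D j0) by rewrite le_max lexx.
    have mD : - D j0 <= Num.max 0 (- D j0) by rewrite le_max lexx orbT.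
    have := ler_wpM2r m0 th; have := ler_wpM2l (sqr_ge0 t) mD; lra.
  lra.
have [k [kx Qk]] := main _ (enum_uniq 'I_n).
exists k; split; first by move=> j; apply: kx; rewrite mem_enum.
move: Qk; rewrite big_enum/=; congr (_ <= Q _ + _).
by apply/funext => j; rewrite mem_enum.
Qed.

Lemma sum_half_le2 N : \sum_(m < N) (1 / 2 : R) ^+ m <= 2.
Proof.
suff : \sum_(m < N) (1 / 2 : R) ^+ m = 2 - 2 * (1 / 2) ^+ N.
  by move=> ->; have := exprn_ge0 N (_ : 0 <= 1 / 2 :> R); lra.
elim: N => [|N IH]; first by rewrite big_ord0 expr0; ring.
by rewrite big_ord_recr/= IH exprS; field.
Qed.

(** Integers satisfy [m <= m ^ 2], so in the ball the magnitudes sum to at most [4 * n] and the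
    weight [2 ^+ (4 * n) * \prod_j (1 / 2) ^+ (k j).2] is at least 1. Summed over all [k] it factors
    into [n] sums, each at most 4 (two signs, a geometric series), and [16 * 4 = 64]. *)
Lemma card_lattice_ball n N :
  \sum_(k : {ffun 'I_n -> bool * 'I_N} |
     \sum_j lattice_val (k j) ^+ 2 <= (4 * n)%:R) (1 : R) <= 64 ^+ n.
Proof.
have lat2 (k : bool * 'I_N) : lattice_val k ^+ 2 = ((k.2 : nat) ^ 2)%:R :> R.
  by rewrite /lattice_val exprMn sqrr_sign mul1r natrX.
apply: (@le_trans _ _ (\sum_(k : {ffun 'I_n -> bool * 'I_N})
    2 ^+ (4 * n) * \prod_j (1 / 2) ^+ (k j).2)).
  rewrite big_mkcond/=; apply: ler_sum => k _.
  have P0 : 0 <= \prod_j (1 / 2 : R) ^+ (k j).2.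
    by apply: prodr_ge0 => j _; rewrite exprn_ge0.
  case: ifP => [|_]; last by rewrite mulr_ge0// exprn_ge0.
  under eq_bigr do rewrite lat2.
  rewrite -natr_sum ler_nat => sumk.
  have sumle : (\sum_j (k j).2 <= 4 * n)%N.
    apply: leq_trans sumk; apply: leq_sum => j _.
    by case: (nat_of_ord (k j).2) => // m; rewrite leq_pmulr.
  rewrite prodrXr -[leLHS](_ : 2 ^+ (4 * n) * (1 / 2) ^+ (4 * n) = 1); last first.
    by rewrite -exprMn mul1r mulfV ?expr1n// pnatr_eq0.
  rewrite ler_wpM2l ?exprn_ge0// ler_wiXn2l//; lra.
rewrite -mulr_sumr -(bigA_distr_bigA (fun (j : 'I_n) (k : bool * 'I_N) => (1 / 2 : R) ^+ k.2)).
rewrite big_const card_ord iter_mulr mulr1.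
have le4 : \sum_(k : bool * 'I_N) (1 / 2 : R) ^+ k.2 <= 4.
  rewrite -(pair_bigA _ (fun (b : bool) (m : 'I_N) => (1 / 2 : R) ^+ m))/=.
  rewrite big_bool/=; apply: (le_trans (lerD (sum_half_le2 N) (sum_half_le2 N))).
  by rewrite -natrD.
have ge0 : 0 <= \sum_(k : bool * 'I_N) (1 / 2 : R) ^+ k.2.
  by apply: sumr_ge0 => k _; rewrite exprn_ge0.
have -> : (64 : R) ^+ n = 2 ^+ (4 * n) * 4 ^+ n.
  by rewrite exprM -exprMn; congr (_ ^+ n); ring.
by rewrite ler_wpM2l ?exprn_ge0// lerXn2r ?nnegrE.
Qed.
End Rounding.

(** * The spiked quadratic form *)

Section SpikedForm.
Context (R : realType) (n p : nat) (mu sigma : 'I_p -> R) (l : 'I_n -> R).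
Implicit Types (e : 'I_p * 'I_n -> R) (x : 'I_n -> R).

Definition noise e x i : R := \sum_j x j * e (i, j).

(* For [|x| = 1] and [Y j i = l j * mu i + e (i, j)], the squared norm of
   [Y^T x] is [<x, l>^2 |mu|^2 + spiked_form e x + \sum_i sigma i ^+ 2]. *)
Definition spiked_form e x : R :=
  \sum_i (2 * (\sum_j x j * l j) * mu i * noise e x i + noise e x i ^+ 2
          - (\sum_j x j ^+ 2) * sigma i ^+ 2).

(** Two values of [c] occur: [2 * l j] in the second-order coefficient of [spiked_form] along
    coordinate [j], and [2 * n%:R * l j] in its expansion at the normalized label vector. *)
Definition diag_form (c : R) e j : R :=
  \sum_i (c * mu i * e (i, j) + e (i, j) ^+ 2 - sigma i ^+ 2).

End SpikedForm.

(** * Exponential moments in the Gaussian model *)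

Section ModelMgf.
Context (R : realType) (n p : nat) (mu sigma : 'I_p -> R) (l : 'I_n -> R)
  (d : measure_display) (T : measurableType d) (P : probability T R)
  (eps : 'I_p * 'I_n -> T -> R).
Hypotheses (meps : forall ij, measurable_fun setT (eps ij))
  (indeps : mutually_independent P eps)
  (laweps : forall ij B, measurable B ->
    P (eps ij @^-1` B) = gauss_law (sigma ij.1) B).

Local Notation e := (fun w ij => eps ij w).

Lemma mgf_linear (t : 'I_p * 'I_n -> R) :
  (\int[P]_w (expR (\sum_ij t ij * eps ij w))%:E =
   (expR (\sum_ij t ij ^+ 2 * sigma ij.1 ^+ 2 / 2))%:E)%E.
Proof.
under eq_integral do rewrite expR_sum.
have E1 ij := gauss_expR (meps ij) (laweps ij) (t ij).
rewrite (integral_prod_indep (f := fun ij x => expR (t ij * x)))//.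
- by under eq_bigr do rewrite E1; rewrite expR_sum -prodEFin.
- by move=> ij; apply: measurableT_comp => //; exact: measurable_funM.
- by move=> ij; rewrite E1 ltry.
Qed.

Lemma measurable_noise x i : measurable_fun setT (fun w => noise (e w) x i).
Proof.
by apply: measurable_fun_sum => j; exact: measurable_funM.
Qed.

Lemma mgf_noise x (th : 'I_p -> R) :
  (\int[P]_w (expR (\sum_i th i * noise (e w) x i))%:E =
   (expR (\sum_i th i ^+ 2 * ((\sum_j x j ^+ 2) * sigma i ^+ 2) / 2))%:E)%E.
Proof.
have := mgf_linear (fun ij => th ij.1 * x ij.2).
rewrite -(pair_bigA _ (fun i j => (th i * x j) ^+ 2 * sigma i ^+ 2 / 2))/=.
have -> : \sum_i \sum_j (th i * x j) ^+ 2 * sigma i ^+ 2 / 2 =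
    \sum_i th i ^+ 2 * ((\sum_j x j ^+ 2) * sigma i ^+ 2) / 2.
  apply: eq_bigr => i _; rewrite mulr_suml mulr_sumr mulr_suml.
  by apply: eq_bigr => j _; rewrite exprMn; ring.
move=> <-; apply: eq_integral => w _; congr (expR _)%:E.
symmetry; transitivity (\sum_ij th ij.1 * x ij.2 * eps (ij.1, ij.2) w).
  by apply: eq_bigr => -[].
rewrite -(pair_bigA _ (fun i j => th i * x j * eps (i, j) w))/=.
by apply: eq_bigr => i _; rewrite mulr_sumr; apply: eq_bigr => j _; rewrite mulrA.
Qed.

(** Linear exponentials of the noise have the moments of independent centered normals of variance
    [|x|^2 * sigma i ^+ 2]. Centering cancels the first-order term of the quadratic bound, leaving
    an exponent quadratic in [lam]. *)
Lemma mgf_spiked_form x (lam : R) : 0 <= lam ->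
  (forall i, lam * ((\sum_j x j ^+ 2) * sigma i ^+ 2) <= 1 / 4) ->
  (\int[P]_w (expR (lam * spiked_form mu sigma l (e w) x))%:E <=
   (expR (\sum_i ((2 * lam * (\sum_j x j * l j) * mu i) ^+ 2 *
            ((\sum_j x j ^+ 2) * sigma i ^+ 2) +
          4 * (lam * ((\sum_j x j ^+ 2) * sigma i ^+ 2)) ^+ 2)))%:E)%E.
Proof.
move=> lam0 lams.
set N := \sum_j x j ^+ 2 in lams *; set c := \sum_j x j * l j.
have N0 : 0 <= N by apply: sumr_ge0 => j _; exact: sqr_ge0.
have sN i : (Num.sqrt N * sigma i) ^+ 2 = N * sigma i ^+ 2.
  by rewrite exprMn sqr_sqrtr.
have := @subgaussian_family_exp_quad _ _ _ P _ (fun i w => noise (e w) x i)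
  (fun i => Num.sqrt N * sigma i) lam (measurable_noise x) lam0.
have lams' i : lam * (Num.sqrt N * sigma i) ^+ 2 <= 1 / 4 by rewrite sN.
move=> /(_ lams').
have H1 : forall th : 'I_p -> R, (\int[P]_w (expR (\sum_i th i * noise (e w) x i))%:E <=
     (expR (\sum_i th i ^+ 2 * (Num.sqrt N * sigma i) ^+ 2 / 2))%:E)%E.
  move=> th; rewrite mgf_noise lee_fin le_eqVlt; apply/orP; left; apply/eqP.
  by congr expR; apply: eq_bigr => i _; rewrite sN.
move=> /(_ H1 (fun i => 2 * lam * c * mu i)) => le1.
pose K := expR (- \sum_i lam * (N * sigma i ^+ 2)).
have -> : (\int[P]_w (expR (lam * spiked_form mu sigma l (e w) x))%:E =
  K%:E * \int[P]_w (expR (\sum_i (2 * lam * c * mu i * noise (e w) x i +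
     lam * noise (e w) x i ^+ 2)))%:E)%E.
  rewrite -ge0_integralZl_real//.
  - apply: eq_integral => w _; rewrite -expRD; congr (expR _)%:E.
    rewrite /spiked_form -/N -/c -sumrN -big_split/= mulr_sumr.
    by apply: eq_bigr => i _; ring.
  - exact: expR_ge0.
  - apply: measurableT_comp => //; apply: measurable_fun_sum => i.
    by apply: measurable_funD; apply: measurable_funM => //;
      [exact: measurable_noise|apply: measurable_funX; exact: measurable_noise].
apply: (le_trans (lee_wpmul2l _ le1)); first by rewrite lee_fin expR_ge0.
rewrite -EFinM -expRD lee_fin ler_expR -sumrN -big_split/=.
by apply: ler_sum => i _; rewrite sN; lra.
Qed.

(** The coefficient of the square is [- kap <= 0], so the condition of [gauss_exp_quad_le] holds for
    every such [kap]. Only column [j] enters; the other factors of the product are 1. *)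
Lemma mgf_diag_form (c kap : R) j : 0 <= kap ->
  (\int[P]_w (expR (- (kap * diag_form mu sigma c (e w) j)))%:E <=
   (expR (\sum_i (4 * (kap * sigma i ^+ 2) ^+ 2 +
       (kap * c * mu i) ^+ 2 * sigma i ^+ 2)))%:E)%E.
Proof.
move=> kap0.
pose f (ij : 'I_p * 'I_n) (x : R) := if ij.2 == j then
  expR (- kap * x ^+ 2 + - (kap * c * mu ij.1) * x) else 1.
have f0 ij x : 0 <= f ij x by rewrite /f; case: ifP => // _; exact: expR_ge0.
have mf ij : measurable_fun setT (f ij).
  rewrite /f; case: (ij.2 == j); last exact: measurable_cst.
  apply: measurableT_comp => //; apply: measurable_funD => //.
  by apply: measurable_funM.
have quad i : (\int[P]_w (f (i, j) (eps (i, j) w))%:E <=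
    (expR (- kap * sigma i ^+ 2 + 4 * (- kap * sigma i ^+ 2) ^+ 2 +
       (- (kap * c * mu i)) ^+ 2 * sigma i ^+ 2))%:E)%E.
  rewrite /f/= eqxx; apply: (gauss_exp_quad_le (meps _) (laweps (i, j)))=> /=.
  have := mulr_ge0 kap0 (sqr_ge0 (sigma i)); lra.
have cst1 ij : (ij.2 == j) = false -> (\int[P]_w (f ij (eps ij w))%:E = 1)%E.
  move=> ijF; rewrite /f ijF.
  transitivity (\int[P]_w (cst 1%E w))%E; first exact: eq_integral.
  by rewrite integral_cst//= probability_setT mul1e.
have ffin ij : (\int[P]_w (f ij (eps ij w))%:E < +oo)%E.
  case: ij => i j'; have [->|jj] := eqVneq j' j.
    by apply: le_lt_trans (quad i) _; rewrite ltry.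
  by rewrite cst1/= ?(negbTE jj)// ltry.
pose K := expR (\sum_i kap * sigma i ^+ 2).
have -> : (\int[P]_w (expR (- (kap * diag_form mu sigma c (e w) j)))%:E =
    K%:E * \int[P]_w (\prod_ij f ij (eps ij w))%:E)%E.
  rewrite -ge0_integralZl_real//.
  - apply: eq_integral => w _; congr EFin.
    transitivity (K * \prod_i \prod_j' f (i, j') (eps (i, j') w)); last first.
      rewrite pair_bigA; congr (_ * _).
      by apply: eq_bigr => -[].
    have E1 i : \prod_j' f (i, j') (eps (i, j') w) =
        expR (- kap * eps (i, j) w ^+ 2 + - (kap * c * mu i) * eps (i, j) w).
      rewrite (bigD1 j)//= big1 ?mulr1 => [|j' jj]; first by rewrite /f/= eqxx.
      by rewrite /f/= (negbTE jj).
    under [X in _ = _ * X]eq_bigr do rewrite E1.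
    rewrite -expR_sum -expRD /diag_form mulr_sumr -sumrN -big_split/=.
    by congr expR; apply: eq_bigr => i _; ring.
  - exact: expR_ge0.
  - by apply: measurable_fun_prod => ij; exact: measurableT_comp.
  - move=> w; apply: (big_ind (fun x : R => 0 <= x)) => // x y x0 y0.
    exact: mulr_ge0.
rewrite (integral_prod_indep meps indeps mf f0 ffin).
have -> : (\prod_ij \int[P]_w (f ij (eps ij w))%:E =
    \prod_i \int[P]_w (f (i, j) (eps (i, j) w))%:E)%E.
  transitivity (\prod_i \prod_j' \int[P]_w (f (i, j') (eps (i, j') w))%:E)%E.
    by rewrite pair_bigA; apply: eq_bigr => -[].
  apply: eq_bigr => i _; rewrite (bigD1 j)//= big1 ?mule1// => j' jj.
  by rewrite cst1//= (negbTE jj).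
apply: (@le_trans _ _ (K%:E * \prod_i (expR (- kap * sigma i ^+ 2 +
    4 * (- kap * sigma i ^+ 2) ^+ 2 +
    (- (kap * c * mu i)) ^+ 2 * sigma i ^+ 2))%:E)%E).
  apply: lee_wpmul2l; first by rewrite lee_fin expR_ge0.
  suff /andP[] : (0 <= \prod_i \int[P]_w (f (i, j) (eps (i, j) w))%:E <=
      \prod_i (expR (- kap * sigma i ^+ 2 + 4 * (- kap * sigma i ^+ 2) ^+ 2 +
        (- (kap * c * mu i)) ^+ 2 * sigma i ^+ 2))%:E)%E by [].
  (* Nonnegativity is carried in the invariant because extended-real inequalities multiply only with
     it. *)
  apply: (big_ind2 (fun x y : \bar R => (0 <= x <= y)%E)).
  - by rewrite lee01 lexx.
  - move=> x1 x2 y1 y2 /andP[x0 xx] /andP[y0 yy].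
    by rewrite mule_ge0//= lee_pmul.
  - by move=> i _; rewrite quad andbT; apply: integral_ge0 => w _; rewrite lee_fin.
rewrite prodEFin -expR_sum -EFinM -expRD lee_fin ler_expR -big_split/=.
by apply: ler_sum => i _; lra.
Qed.

End ModelMgf.

(** * Deterministic comparison for fixed noise *)

Section Pointwise.
Context (R : realType) (n p : nat) (mu sigma : 'I_p -> R) (l : 'I_n -> R)
  (e : 'I_p * 'I_n -> R).
Hypotheses (n0 : (0 < n)%N) (hl : forall j, l j = 1 \/ l j = -1).

Local Notation G := (spiked_form mu sigma l e).
Local Notation D := (diag_form mu sigma).

Let sqr_l j : l j ^+ 2 = 1.
Proof. by case: (hl j) => ->; rewrite ?sqrrN expr1n. Qed.

Let nR0 : (0 : R) < n%:R. Proof. by rewrite ltr0n. Qed.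

Lemma gram_spiked_form (u : 'rV[R]_n) :
  let Y := \matrix_(j < n, i < p) (l j * mu i + e (i, j)) in
  bform (Y *m Y^T) u u = (\sum_j u 0 j * l j) ^+ 2 * (\sum_i mu i ^+ 2)
    + G (u 0) + (\sum_j u 0 j ^+ 2) * \sum_i sigma i ^+ 2.
Proof.
move=> Y; rewrite /bform mulmxA -mulmxA -[X in _ *m X]trmx_mul.
rewrite dotE /spiked_form [(\sum_j u 0 j * l j) ^+ 2 * _]mulr_sumr.
rewrite [(\sum_j u 0 j ^+ 2) * _]mulr_sumr -!big_split/=; apply: eq_bigr => i _.
have -> : (u *m Y) 0 i = (\sum_j u 0 j * l j) * mu i + noise e (u 0) i.
  rewrite mxE mulr_suml -big_split/=; apply: eq_bigr => j _.
  by rewrite mxE; ring.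
by ring.
Qed.

Lemma spiked_form_update x j t :
  G (update x j t) = G x + t * (\sum_i (2 * l j * mu i * noise e x i +
      2 * (\sum_k x k * l k) * mu i * e (i, j) + 2 * noise e x i * e (i, j)
      - 2 * x j * sigma i ^+ 2)) + t ^+ 2 * D (2 * l j) e j.
Proof.
have lin (a : 'I_n -> R) : \sum_k update x j t k * a k = \sum_k x k * a k + t * a j.
  under eq_bigr do rewrite /update mulrDl.
  rewrite big_split/=; congr (_ + _); rewrite (bigD1 j)//= eqxx mul1r big1 ?addr0//.
  by move=> k /negbTE ->; rewrite !mul0r.
have sq : \sum_k update x j t k ^+ 2 = \sum_k x k ^+ 2 + 2 * t * x j + t ^+ 2.
  under eq_bigr do rewrite expr2.
  rewrite lin; under eq_bigr do rewrite mulrC.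
  rewrite lin /update eqxx mul1r.
  by under eq_bigr do rewrite -expr2; ring.
rewrite /spiked_form /diag_form [t * _]mulr_sumr [t ^+ 2 * _]mulr_sumr -!big_split/=; apply: eq_bigr => i _.
by rewrite sq /noise !lin; ring.
Qed.

Definition off_diag : R :=
  \sum_i \sum_j \sum_(k | k != j) l j * l k * (e (i, j) * e (i, k)).

Let h : R := (Num.sqrt n%:R)^-1.
Let h2 : h ^+ 2 = n%:R^-1. Proof. by rewrite exprVn sqr_sqrtr// ler0n. Qed.
Let h0 : 0 < h. Proof. by rewrite invr_gt0 sqrtr_gt0. Qed.

(** Expanding the square of [\sum_j l j * e (i, j)] with [l j ^+ 2 = 1] separates squares from cross
    products: the squares join the linear and centering terms, and the cross products are isolated
    for their mean zero. *)
Lemma spiked_form_label :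
  n%:R * G (fun j => h * l j) = \sum_j D (2 * n%:R * l j) e j + off_diag.
Proof.
have nN0 : n%:R != 0 :> R by rewrite gt_eqF.
have E1 : \sum_j h * l j * l j = h * n%:R.
  under eq_bigr do rewrite -mulrA -expr2 sqr_l mulr1.
  by rewrite sumr_const card_ord mulr_natr.
have E2 : \sum_j (h * l j) ^+ 2 = 1.
  under eq_bigr do rewrite exprMn sqr_l mulr1 h2.
  by rewrite sumr_const card_ord -[LHS]mulr_natr mulVf.
rewrite /spiked_form /off_diag E1 E2 /diag_form exchange_big/= -big_split/= mulr_sumr.
apply: eq_bigr => i _.
have -> : noise e (fun j => h * l j) i = h * \sum_j l j * e (i, j).
  by rewrite /noise mulr_sumr; apply: eq_bigr => j _; rewrite mulrA.
set s := \sum_j l j * e (i, j).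
have s2 : s ^+ 2 = \sum_j e (i, j) ^+ 2 +
    \sum_j \sum_(k | k != j) l j * l k * (e (i, j) * e (i, k)).
  rewrite expr2 {1}/s mulr_suml -big_split/=; apply: eq_bigr => j _.
  rewrite /s mulr_sumr (bigD1 j)//=; congr (_ + _).
    by rewrite mulrACA -!expr2 sqr_l mul1r.
  by apply: eq_bigr => k _; ring.
have -> : \sum_j (2 * n%:R * l j * mu i * e (i, j) + e (i, j) ^+ 2 - sigma i ^+ 2)
    = 2 * n%:R * mu i * s + \sum_j e (i, j) ^+ 2 - n%:R * sigma i ^+ 2.
  rewrite !big_split/= sumrN sumr_const card_ord -[sigma i ^+ 2 *+ n]mulr_natl.
  congr (_ + _ - _); rewrite /s mulr_sumr; apply: eq_bigr => j _; ring.
have -> : 2 * (h * n%:R) * mu i * (h * s) + (h * s) ^+ 2 - 1 * sigma i ^+ 2 =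
    h ^+ 2 * (2 * n%:R * mu i * s + s ^+ 2) - sigma i ^+ 2 by ring.
by rewrite h2 s2; field.
Qed.

(** The unit vector [l / sqrt n] has squared overlap [n] with [l]; maximality of [v] is tested
    against it, and the trace term [\sum_i sigma i ^+ 2] cancels between unit vectors. *)
Lemma overlap_le v :
  let Y := \matrix_(j < n, i < p) (l j * mu i + e (i, j)) in
  unit_leading_eigvec (Y *m Y^T) v ->
  (\sum_i mu i ^+ 2) * (n%:R - (\sum_j v 0 j * l j) ^+ 2) <=
    G (v 0) - G (fun j => h * l j).
Proof.
move=> Y lv; have v1 := lv.1.
pose u : 'rV[R]_n := \row_j (h * l j).
have uE : (u 0 : 'I_n -> R) = (fun j => h * l j).
  by apply/funext => j; rewrite mxE.
have u1 : \sum_j u 0 j ^+ 2 = 1.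
  under eq_bigr do rewrite mxE exprMn sqr_l mulr1 h2.
  by rewrite sumr_const card_ord -[LHS]mulr_natr mulVf// gt_eqF.
have ul : (\sum_j u 0 j * l j) ^+ 2 = n%:R.
  under eq_bigr do rewrite mxE -mulrA -expr2 sqr_l mulr1.
  rewrite sumr_const card_ord -[X in X ^+ 2]mulr_natr exprMn h2; field; by rewrite gt_eqF.
have YT : (Y *m Y^T)^T = Y *m Y^T by rewrite trmx_mul trmxK.
have := leading_eigvec_max YT lv u1.
by rewrite !gram_spiked_form u1 v1 ul uE; lra.
Qed.

End Pointwise.

(** * Reduction to finitely many exponentials *)

Section NetBound.
Context (R : realType) (n p : nat) (mu sigma : 'I_p -> R) (l : 'I_n -> R)
  (e : 'I_p * 'I_n -> R).
Hypotheses (n0 : (0 < n)%N) (hl : forall j, l j = 1 \/ l j = -1).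

Local Notation G := (spiked_form mu sigma l).
Local Notation D := (diag_form mu sigma).
Local Notation net := {ffun 'I_n -> bool * 'I_n.+2}.

Definition net_point (k : net) (j : 'I_n) : R :=
  (Num.sqrt n%:R)^-1 * lattice_val R (k j).

Definition net_ball : {pred net} :=
  [pred k : net | \sum_j lattice_val R (k j) ^+ 2 <= (4 * n)%:R].

Let nR0 : (0 : R) < n%:R. Proof. by rewrite ltr0n. Qed.
Let h : R := (Num.sqrt n%:R)^-1.
Let h2 : h ^+ 2 = n%:R^-1. Proof. by rewrite exprVn sqr_sqrtr// ler0n. Qed.
Let h0 : 0 < h. Proof. by rewrite invr_gt0 sqrtr_gt0. Qed.

Lemma net_point_norm k : k \in net_ball -> \sum_j net_point k j ^+ 2 <= 4.
Proof.
rewrite inE => kb; under eq_bigr do rewrite exprMn h2.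
by rewrite -mulr_sumr mulrC ler_pdivrMr// -natrM.
Qed.

Lemma net_approx (v : 'I_n -> R) : \sum_j v j ^+ 2 = 1 ->
  exists2 k, k \in net_ball &
    G e v <= G e (net_point k) + n%:R^-1 * \sum_j Num.max 0 (- D (2 * l j) e j).
Proof.
move=> v1.
have vle j : v j ^+ 2 <= 1.
  by rewrite -v1 (bigD1 j)//= lerDl; apply: sumr_ge0 => k _; exact: sqr_ge0.
have n1 : (1 : R) <= n%:R by rewrite ler1n.
have rn : Num.sqrt n%:R <= n%:R :> R.
  rewrite -(@ler_pXn2r _ 2) ?nnegrE ?sqrtr_ge0 ?ler0n// sqr_sqrtr ?ler0n//.
  by rewrite expr2 ler_peMl.
(* The range [n.+2] suffices: [|v j| * sqrt n <= n], and rounding needs a strict margin of 1. *)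
have [] := @greedy_rounding R n n.+2 (G e) (fun j => D (2 * l j) e j) _ h v
  (fun y j t => spiked_form_update mu sigma l e y j t) isT h0.
  move=> j; rewrite /h invrK normrM (ger0_norm (sqrtr_ge0 _)).
  have v1j : `|v j| <= 1.
    by rewrite -(@ler_pXn2r _ 2) ?nnegrE// expr1n real_normK ?num_real.
  have := ler_pM (normr_ge0 (v j)) (sqrtr_ge0 (n%:R : R)) v1j rn.
  by rewrite -addn2 natrD; lra.
move=> k [kv Gk]; exists k; last by rewrite -h2.
(* Summed over [j] this gives [2 + 2 = 4], the squared radius of [net_ball] after scaling. *)
have hk j : (h * lattice_val R (k j)) ^+ 2 <= 2 * v j ^+ 2 + 2 * h ^+ 2.
  have := kv j; rewrite -(@ler_pXn2r _ 2) ?nnegrE ?(ltW h0)// real_normK ?num_real// => H.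
  have := sqr_ge0 (h * lattice_val R (k j) - 2 * v j); lra.
have : \sum_j (h * lattice_val R (k j)) ^+ 2 <= \sum_j (2 * v j ^+ 2 + 2 * h ^+ 2).
  by apply: ler_sum => j _; exact: hk.
rewrite big_split/= -mulr_sumr v1 sumr_const card_ord h2.
under eq_bigr do rewrite exprMn h2.
have -> : (2 / n%:R) *+ n = 2 :> R by rewrite -[LHS]mulr_natr divfK// gt_eqF.
rewrite -mulr_sumr ler_pdivrMl// inE natrM => le1.
by apply: (le_trans le1); lra.
Qed.

(** The right side is free of [v], so it can be integrated. The inequality [y <= a + expR (y - a)]
    is used with [a = 7 * n%:R] on the net, to offset its cardinality, and [a = 0] on the diagonal
    terms; the net point near [v] is covered by summing over the whole net. *)
Lemma misclass_net_bound (v : 'rV[R]_n) (lam : R) : 0 <= lam ->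
  let Y := \matrix_(j < n, i < p) (l j * mu i + e (i, j)) in
  unit_leading_eigvec (Y *m Y^T) v ->
  lam * n%:R * (\sum_i mu i ^+ 2) / 2 * misclass l (fun j => Num.sg (v 0 j)) <=
    (7 * n%:R + \sum_(k in net_ball) expR (- (7 * n%:R)) * expR (lam * G e (net_point k))
     + \sum_j expR (- (lam / n%:R * D (2 * l j) e j))
     + \sum_j expR (- (lam / n%:R * D (2 * n%:R * l j) e j)))
    - lam / n%:R * off_diag l e.
Proof.
move=> lam0 Y lv.
have v1 : \sum_j v 0 j ^+ 2 = 1 := lv.1.
have mu0 : 0 <= \sum_i mu i ^+ 2 by apply: sumr_ge0 => i _; exact: sqr_ge0.
have ov := overlap_le sigma n0 hl lv.
have mc := misclass_le_overlap n0 hl v1.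
have [k kb Gk] := net_approx v1.
have lab := spiked_form_label mu sigma e n0 hl.
pose Gl := G e (fun j => (Num.sqrt n%:R)^-1 * l j).
rewrite -/Gl in ov lab.
set S := \sum_j _ in Gk.
set M := misclass _ _ in mc *.
have kap0 : 0 <= lam / n%:R by rewrite divr_ge0// ltW.
have leS : lam / n%:R * S <= \sum_j expR (- (lam / n%:R * D (2 * l j) e j)).
  rewrite /S mulr_sumr; apply: ler_sum => j _.
  rewrite maxr_pMr// mulr0 mulrN ge_max expR_ge0/=.
  by apply: le_trans (expR_ge1Dx _); rewrite lerDr.
have leD : - (lam / n%:R) * (\sum_j D (2 * n%:R * l j) e j) <=
    \sum_j expR (- (lam / n%:R * D (2 * n%:R * l j) e j)).
  rewrite mulr_sumr; apply: ler_sum => j _; rewrite mulNr.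
  by apply: le_trans (expR_ge1Dx _); rewrite lerDr.
have leK : lam * G e (net_point k) <= 7 * n%:R +
    \sum_(k in net_ball) expR (- (7 * n%:R)) * expR (lam * G e (net_point k)).
  rewrite (bigD1 k)//= -expRD.
  have rest : 0 <= \sum_(i in net_ball | i != k)
      expR (- (7 * n%:R)) * expR (lam * G e (net_point i)).
    by apply: sumr_ge0 => i _; rewrite mulr_ge0 ?expR_ge0.
  have := expR_ge1Dx (- (7 * n%:R) + lam * G e (net_point k)); lra.
have E1 : lam * n%:R * (\sum_i mu i ^+ 2) / 2 * M <=
    lam * (G e (v 0) - Gl).
  move: mc ov mu0; set m2 := \sum_i mu i ^+ 2; set c := \sum_j _ * _.
  move=> mc ov mu0; have := ler_wpM2l (mulr_ge0 lam0 mu0) mc.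
  have := ler_wpM2l lam0 ov. lra.
have E2 : lam * G e (v 0) <= lam * G e (net_point k) + lam / n%:R * S.
  by rewrite -mulrA -mulrDr ler_wpM2l.
have E3 : lam * Gl = lam / n%:R * (\sum_j D (2 * n%:R * l j) e j) +
    lam / n%:R * off_diag l e.
  by rewrite -mulrDr -lab; field; rewrite gt_eqF.
lra.
Qed.

End NetBound.

(** * The mean of the supremum *)

Section Expectation.
Context (R : realType) (n p : nat) (mu sigma : 'I_p -> R) (l : 'I_n -> R)
  (d : measure_display) (T : measurableType d) (P : probability T R)
  (eps : 'I_p * 'I_n -> T -> R).
Hypotheses (n0 : (0 < n)%N) (hl : forall j, l j = 1 \/ l j = -1)
  (meps : forall ij, measurable_fun setT (eps ij))
  (indeps : mutually_independent P eps)
  (laweps : forall ij B, measurable B ->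
    P (eps ij @^-1` B) = gauss_law (sigma ij.1) B).

Local Notation e := (fun w ij => eps ij w).
Local Notation G := (spiked_form mu sigma l).
Local Notation D := (diag_form mu sigma).

Let nR0 : (0 : R) < n%:R. Proof. by rewrite ltr0n. Qed.
Let n1 : (1 : R) <= n%:R. Proof. by rewrite ler1n. Qed.

(* No measurability: the leading eigenvector is not assumed to be a measurable
   function of [w]. *)
Lemma le_integral_nonmeasurable (f g : T -> \bar R) :
  (forall w, 0 <= f w)%E -> (forall w, f w <= g w)%E ->
  (\int[P]_w f w <= \int[P]_w g w)%E.
Proof.
move=> f0 fg; have g0 w : (0 <= g w)%E by exact: le_trans (f0 w) (fg w).
rewrite !ge0_integralTE//; apply: le_ereal_sup => _ [h hf <-].
by exists h => // w; exact: le_trans (hf w) (fg w).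
Qed.

Lemma off_diag_mean :
  P.-integrable setT (fun w => (off_diag l (e w))%:E) /\
  (\int[P]_w (off_diag l (e w))%:E = 0)%E.
Proof.
have cm i j k : k != j -> P.-integrable setT (fun w => (eps (i, j) w * eps (i, k) w)%:E) /\
    (\int[P]_w (eps (i, j) w * eps (i, k) w)%:E = 0)%E.
  move=> kj; apply: (@cross_moment R d T P _ eps meps indeps (i, j) (i, k)).
  - by rewrite xpair_eqE eqxx/= eq_sym.
  - exact: (gauss_abs_lty (meps _) (laweps _)).
  - exact: (gauss_abs_lty (meps _) (laweps _)).
  - by move=> f mf f0; exact: (gauss_sym (meps _) (laweps _)).
pose t i j k w : \bar R := if k != j
  then ((l j * l k)%:E * (eps (i, j) w * eps (i, k) w)%:E)%E else 0%E.
have ti i j k : P.-integrable setT (t i j k).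
  rewrite /t; case: eqVneq => kj/=; first exact: integrable0.
  by apply: integrableZl => //; have [] := cm i j k kj.
have offE w : (off_diag l (e w))%:E = (\sum_i \sum_j \sum_k t i j k w)%E.
  rewrite /off_diag -sumEFin; apply: eq_bigr => i _.
  rewrite -sumEFin; apply: eq_bigr => j _.
  by rewrite -sumEFin big_mkcond/=; apply: eq_bigr => k _; rewrite /t; case: ifP.
have sk i j : P.-integrable setT (fun w => \sum_k t i j k w)%E.
  by apply: integrable_sum.
have sj i : P.-integrable setT (fun w => \sum_j \sum_k t i j k w)%E.
  by apply: integrable_sum.
split.
  apply: (eq_integrable measurableT (fun w => \sum_i \sum_j \sum_k t i j k w)%E) => //.
  by apply: integrable_sum.
under eq_integral do rewrite offE.
rewrite integral_sum// big1// => i _.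
rewrite integral_sum// big1// => j _.
rewrite integral_sum// big1// => k _.
rewrite /t; case: eqVneq => kj/=; first exact: integral0.
have [ci c0] := cm i j k kj.
by rewrite integralZl// c0 mule0.
Qed.

(** [B] stands for the numerator of the final ratio; the three conditions match its terms
    [n |mu| sigma_*], [n sigma_*^2] and [sqrt n] times the squared [sigma_tilde]. *)
Variable B : R.
Hypotheses (B0 : 0 < B)
  (hmu : n%:R ^+ 2 * (\sum_i mu i ^+ 2 * sigma i ^+ 2) <= B ^+ 2)
  (hsig : forall i, n%:R * sigma i ^+ 2 <= B)
  (hsig4 : n%:R * (\sum_i sigma i ^+ 4) <= B ^+ 2).

(** The 16 gives [lam * sigma i ^+ 2 <= 1 / 16], hence the threshold 1/4 of [mgf_spiked_form] for
    points of squared norm at most 4. *)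
Let lam : R := n%:R / (16 * B).
Let lam0 : 0 <= lam.
Proof. by rewrite divr_ge0 ?ler0n// mulr_ge0// ltW. Qed.
Let S4 : R := \sum_i sigma i ^+ 4.
Let M2 : R := \sum_i mu i ^+ 2 * sigma i ^+ 2.
Let S4_ge0 : 0 <= S4.
Proof. by apply: sumr_ge0 => i _; rewrite exprn_even_ge0. Qed.
Let M2_ge0 : 0 <= M2.
Proof. by apply: sumr_ge0 => i _; rewrite mulr_ge0 ?sqr_ge0. Qed.

Let lam_S4 : lam ^+ 2 * S4 <= n%:R / 256.
Proof.
have -> : lam ^+ 2 * S4 = n%:R / 256 * (n%:R * S4 / B ^+ 2).
  by rewrite /lam; field; rewrite gt_eqF.
rewrite -[leRHS]mulr1 ler_wpM2l ?divr_ge0 ?ler0n//.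
by rewrite ler_pdivrMr ?exprn_gt0// mul1r.
Qed.

Let lam_M2 : lam ^+ 2 * M2 <= 1 / 256.
Proof.
have -> : lam ^+ 2 * M2 = 1 / 256 * (n%:R ^+ 2 * M2 / B ^+ 2).
  by rewrite /lam; field; rewrite gt_eqF.
rewrite -[leRHS]mulr1 ler_wpM2l ?divr_ge0//.
by rewrite ler_pdivrMr ?exprn_gt0// mul1r.
Qed.

(** With [|x|^2 <= 4] and [c ^+ 2 <= 4 * n%:R] the exponent is at most [64 * n%:R * lam ^+ 2 * M2 +
    64 * lam ^+ 2 * S4], and each of the two terms is at most [n / 4]. *)
Lemma net_mgf k : k \in @net_ball R n ->
  (\int[P]_w (expR (lam * G (e w) (net_point R k)))%:E <= (expR n%:R)%:E)%E.
Proof.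
move=> kb; set x := net_point R k.
have N4 : \sum_j x j ^+ 2 <= 4 by exact: net_point_norm.
have N0 : 0 <= \sum_j x j ^+ 2 by apply: sumr_ge0 => j _; exact: sqr_ge0.
have lams i : lam * ((\sum_j x j ^+ 2) * sigma i ^+ 2) <= 1 / 4.
  have s0 := sqr_ge0 (sigma i).
  have : lam * sigma i ^+ 2 <= 1 / 16.
    rewrite /lam mulrAC ler_pdivrMr ?mulr_gt0//; have := hsig i; lra.
  have := ler_wpM2r (mulr_ge0 lam0 s0) N4; lra.
apply: le_trans (mgf_spiked_form mu l meps indeps laweps lam0 lams) _.
rewrite lee_fin ler_expR.
set N := \sum_j x j ^+ 2 in N4 N0 lams *; set c := \sum_j x j * l j.
have c2 : c ^+ 2 <= 4 * n%:R.
  (* Cauchy-Schwarz for [x] and [l], written as a sum of squares. *)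
  have : 0 <= \sum_j (n%:R * x j - c * l j) ^+ 2.
    by apply: sumr_ge0 => j _; exact: sqr_ge0.
  have -> : \sum_j (n%:R * x j - c * l j) ^+ 2 = n%:R * (n%:R * N - c ^+ 2).
    transitivity (\sum_j (n%:R ^+ 2 * x j ^+ 2 - 2 * n%:R * c * (x j * l j) + c ^+ 2)).
      apply: eq_bigr => j _; have : l j ^+ 2 = 1 by case: (hl j) => ->; rewrite ?sqrrN expr1n.
      move=> l2; transitivity (n%:R ^+ 2 * x j ^+ 2 - 2 * n%:R * c * (x j * l j)
          + c ^+ 2 * l j ^+ 2).
        by ring.
      by rewrite l2 mulr1.
    rewrite !big_split/= sumrN -2!mulr_sumr sumr_const card_ord -/N -/c.
    by rewrite -[c ^+ 2 *+ n]mulr_natl; ring.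
  rewrite pmulr_rge0// subr_ge0 => c2; apply: (le_trans c2).
  by rewrite mulrC ler_wpM2r// ler0n.
apply: (@le_trans _ _ (\sum_i (64 * n%:R * (lam ^+ 2 * (mu i ^+ 2 * sigma i ^+ 2)) +
    64 * (lam ^+ 2 * sigma i ^+ 4)))).
  apply: ler_sum => i _; apply: lerD.
    have -> : (2 * lam * c * mu i) ^+ 2 * (N * sigma i ^+ 2) =
      4 * (lam ^+ 2 * (mu i ^+ 2 * sigma i ^+ 2)) * (c ^+ 2 * N) by ring.
    have -> : 64 * n%:R * (lam ^+ 2 * (mu i ^+ 2 * sigma i ^+ 2)) =
      4 * (lam ^+ 2 * (mu i ^+ 2 * sigma i ^+ 2)) * (4 * n%:R * 4) by ring.
    apply: ler_wpM2l; first by rewrite mulr_ge0// mulr_ge0 ?sqr_ge0// mulr_ge0 ?sqr_ge0.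
    by apply: ler_pM => //; exact: sqr_ge0.
  have -> : 4 * (lam * (N * sigma i ^+ 2)) ^+ 2 = 4 * (lam ^+ 2 * sigma i ^+ 4) * N ^+ 2 by ring.
  have -> : 64 * (lam ^+ 2 * sigma i ^+ 4) = 4 * (lam ^+ 2 * sigma i ^+ 4) * 4 ^+ 2 by ring.
  apply: ler_wpM2l; first by rewrite mulr_ge0// mulr_ge0 ?sqr_ge0// exprn_even_ge0.
  by rewrite lerXn2r ?nnegrE.
rewrite big_split/= -!mulr_sumr -/S4 -/M2.
have := ler_wpM2l (ltW nR0) lam_M2; have := lam_S4; have := nR0; lra.
Qed.

Lemma diag_mgf c j : c ^+ 2 <= 4 * n%:R ^+ 2 ->
  (\int[P]_w (expR (- (lam / n%:R * D c (e w) j)))%:E <= 2%:E)%E.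
Proof.
move=> c2.
have kap0 : 0 <= lam / n%:R by rewrite divr_ge0 ?ler0n.
apply: le_trans (mgf_diag_form mu meps indeps laweps c j kap0) _.
set kap := lam / n%:R; rewrite lee_fin.
have lamE : lam = kap * n%:R by rewrite /kap divfK// gt_eqF.
have kS : kap ^+ 2 * S4 <= 1 / 256.
  have S0 : 0 <= kap ^+ 2 * S4 by rewrite mulr_ge0 ?sqr_ge0.
  have := lam_S4.
  have -> : lam ^+ 2 * S4 = n%:R * (n%:R * (kap ^+ 2 * S4)) by rewrite lamE; ring.
  rewrite ler_pM2l// => le1.
  by have := ler_wpM2r S0 n1; lra.
have kM : n%:R ^+ 2 * (kap ^+ 2 * M2) <= 1 / 256.
  by have := lam_M2; rewrite lamE exprMn; congr (_ <= _); ring.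
have q12 : \sum_i (4 * (kap * sigma i ^+ 2) ^+ 2 +
      (kap * c * mu i) ^+ 2 * sigma i ^+ 2) <= 1 / 2.
  rewrite big_split/=.
  have -> : \sum_i 4 * (kap * sigma i ^+ 2) ^+ 2 = 4 * (kap ^+ 2 * S4).
    by rewrite /S4 !mulr_sumr; apply: eq_bigr => i _; ring.
  have -> : \sum_i (kap * c * mu i) ^+ 2 * sigma i ^+ 2 = c ^+ 2 * (kap ^+ 2 * M2).
    by rewrite /M2 !mulr_sumr; apply: eq_bigr => i _; ring.
  have := ler_wpM2r (mulr_ge0 (sqr_ge0 kap) M2_ge0) c2; lra.
(* [expR (1 / 2) <= 2] follows from [expR (- (1 / 2)) >= 1 / 2] by inversion. *)
apply: (@le_trans _ _ (expR (1 / 2))); first by rewrite ler_expR.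
have := expR_ge1Dx (- (1 / 2) : R); rewrite expRN => le1.
rewrite -[leLHS]invrK -[leRHS]invrK lef_pV2 ?posrE ?invr_gt0 ?expR_gt0//; lra.
Qed.

Lemma integral_sum_le (I : finType) (A : {pred I}) (f : I -> T -> R) (b : R) :
  (forall i, measurable_fun setT (f i)) -> (forall i w, 0 <= f i w) ->
  (forall i, i \in A -> (\int[P]_w (f i w)%:E <= b%:E)%E) ->
  (\int[P]_w (\sum_(i in A) f i w)%:E <= (b * \sum_(i in A) 1)%:E)%E.
Proof.
move=> mf f0 fb.
under eq_integral do rewrite -big_enum/= -sumEFin.
rewrite ge0_integral_sum//; last 2 first.
- by move=> i; exact/measurable_EFinP.
- by move=> i w _; rewrite lee_fin.
rewrite mulr_sumr -sumEFin big_enum/=.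
by apply: lee_sum => i iA; rewrite mulr1; exact: fb.
Qed.

Lemma expected_misclass (vhat : T -> 'rV[R]_n) :
  0 < \sum_i mu i ^+ 2 ->
  (forall w, unit_leading_eigvec
     ((\matrix_(j < n, i < p) (l j * mu i + eps (i, j) w)) *m
      (\matrix_(j < n, i < p) (l j * mu i + eps (i, j) w))^T) (vhat w)) ->
  (\int[P]_w (misclass l (fun j => Num.sg (vhat w 0 j)))%:E <=
   (384 * B / (n%:R * \sum_i mu i ^+ 2))%:E)%E.
Proof.
move=> mu0 hv; set m2 := \sum_i mu i ^+ 2 in mu0 *.
have lamP : 0 < lam by rewrite divr_gt0// mulr_gt0.
pose H w : R := (7 * n%:R + \sum_(k in @net_ball R n)
      expR (- (7 * n%:R)) * expR (lam * G (e w) (net_point R k))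
     + \sum_j expR (- (lam / n%:R * D (2 * l j) (e w) j))
     + \sum_j expR (- (lam / n%:R * D (2 * n%:R * l j) (e w) j))).
pose c := lam * n%:R * m2 / 2.
have c0 : 0 < c by apply: divr_gt0 => //; apply: mulr_gt0 => //; exact: mulr_gt0.
have key w : c * misclass l (fun j => Num.sg (vhat w 0 j)) <=
    H w - lam / n%:R * off_diag l (e w).
  exact: (@misclass_net_bound R n p mu sigma l (e w) n0 hl _ _ lam0 (hv w)).
have mG x : measurable_fun setT (fun w => G (e w) x).
  apply: measurable_fun_sum => i; have mn := measurable_noise meps x i.
  apply: measurable_funB => //; apply: measurable_funD; last exact: measurable_funX.
  exact: measurable_funM.
have mD a j : measurable_fun setT (fun w => D a (e w) j).
  apply: measurable_fun_sum => i; apply: measurable_funB => //.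
  by apply: measurable_funD; [exact: measurable_funM|exact: measurable_funX].
have mDe a j : measurable_fun setT (fun w => expR (- (lam / n%:R * D a (e w) j))).
  apply: measurableT_comp => //; apply: measurable_funN.
  exact: measurable_funM.
have mGe k : measurable_fun setT
    (fun w => expR (- (7 * n%:R)) * expR (lam * G (e w) (net_point R k))).
  by apply: measurable_funM => //; apply: measurableT_comp => //; exact: measurable_funM.
have c2 j : (2 * l j) ^+ 2 <= 4 * n%:R ^+ 2 :> R.
  have -> : (2 * l j) ^+ 2 = 4 :> R.
    by rewrite exprMn; case: (hl j) => ->; rewrite ?sqrrN expr1n mulr1 -natrX.
  by have := ler_pM ler01 ler01 n1 n1; rewrite expr2; lra.
have c2n j : (2 * n%:R * l j) ^+ 2 <= 4 * n%:R ^+ 2 :> R.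
  have -> : (2 * n%:R * l j) ^+ 2 = 4 * n%:R ^+ 2 * l j ^+ 2 :> R by ring.
  by case: (hl j) => ->; rewrite ?sqrrN expr1n mulr1.
have fin_D (a : 'I_n -> R) : (forall j, a j ^+ 2 <= 4 * n%:R ^+ 2) ->
    (\int[P]_w (\sum_j expR (- (lam / n%:R * D (a j) (e w) j)))%:E
      <= (2 * n%:R)%:E)%E.
  move=> ha; have := @integral_sum_le _ predT
    (fun j w => expR (- (lam / n%:R * D (a j) (e w) j))) 2 (fun j => mDe (a j) j)
    (fun j w => expR_ge0 _) (fun j _ => diag_mgf j (ha j)).
  by rewrite sumr_const card_ord.
have fin_k : (\int[P]_w (\sum_(k in @net_ball R n)
      expR (- (7 * n%:R)) * expR (lam * G (e w) (net_point R k)))%:E <= 1%:E)%E.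
  have bnd k : k \in @net_ball R n -> (\int[P]_w (expR (- (7 * n%:R)) *
      expR (lam * G (e w) (net_point R k)))%:E <=
      (expR (- (7 * n%:R)) * expR n%:R)%:E)%E.
    move=> kb; rewrite ge0_integralZl_real ?expR_ge0//.
      by rewrite EFinM lee_wpmul2l ?lee_fin ?expR_ge0//; exact: net_mgf.
    by apply: measurableT_comp => //; exact: measurable_funM.
  have nn k w : 0 <= expR (- (7 * n%:R)) * expR (lam * G (e w) (net_point R k)).
    by rewrite mulr_ge0 ?expR_ge0.
  apply: le_trans (@integral_sum_le _ (@net_ball R n) _ _ mGe nn bnd) _.
  rewrite lee_fin; apply: (le_trans (ler_wpM2l _ (card_lattice_ball R n n.+2))).
    by rewrite mulr_ge0 ?expR_ge0.
  (* Since [64 = 2 ^+ 6], the cardinality is at most [expR (6 * n)]; with the moment [expR n] it is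
     balanced exactly by the shift [7 * n]. *)
  have e2 : (2 : R) <= expR 1 by have := expR_ge1Dx (1 : R); lra.
  have -> : (64 : R) ^+ n = (2 ^+ 6) ^+ n by congr (_ ^+ n); rewrite -natrX.
  rewrite -exprM.
  apply: (@le_trans _ _ (expR (- (7 * n%:R)) * expR n%:R * expR 1 ^+ (6 * n))).
    by rewrite ler_wpM2l ?mulr_ge0 ?expR_ge0// lerXn2r ?nnegrE ?expR_ge0.
  rewrite -expRM_natl -!expRD -[leRHS]expR0 ler_expR natrM; lra.
have mH : measurable_fun setT H.
  apply: measurable_funD; last by apply: measurable_fun_sum.
  apply: measurable_funD; last by apply: measurable_fun_sum.
  by apply: measurable_funD => //; apply: measurable_fun_sum.
have H0 w : 0 <= H w.
  rewrite !addr_ge0 ?mulr_ge0 ?ler0n//; apply: sumr_ge0 => i _.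
  - by rewrite mulr_ge0 ?expR_ge0.
  - exact: expR_ge0.
  - exact: expR_ge0.
have intH : (\int[P]_w (H w)%:E <= (12 * n%:R)%:E)%E.
  have intD (f g : T -> R) : measurable_fun setT f -> measurable_fun setT g ->
      (forall w, 0 <= f w) -> (forall w, 0 <= g w) ->
      (\int[P]_w (f w + g w)%:E = \int[P]_w (f w)%:E + \int[P]_w (g w)%:E)%E.
    move=> mf mg f0 g0; under eq_integral do rewrite EFinD.
    rewrite ge0_integralD//.
    - by move=> w _; rewrite lee_fin.
    - exact/measurable_EFinP.
    - by move=> w _; rewrite lee_fin.
    - exact/measurable_EFinP.
  have mS a : measurable_fun setT
      (fun w => \sum_j expR (- (lam / n%:R * D (a j) (e w) j))).
    by apply: measurable_fun_sum.
  have S0 (a : 'I_n -> R) w : 0 <= \sum_j expR (- (lam / n%:R * D (a j) (e w) j)).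
    by apply: sumr_ge0 => j _; exact: expR_ge0.
  pose K w := \sum_(k in @net_ball R n)
      expR (- (7 * n%:R)) * expR (lam * G (e w) (net_point R k)).
  have mK : measurable_fun setT K by apply: measurable_fun_sum.
  have K0 w : 0 <= K w by apply: sumr_ge0 => k _; rewrite mulr_ge0 ?expR_ge0.
  have n7 : 0 <= 7 * n%:R :> R by rewrite mulr_ge0.
  rewrite (intD (fun w => 7 * n%:R + K w +
    \sum_j expR (- (lam / n%:R * D (2 * l j) (e w) j))))//; first last.
  - by move=> w; rewrite !addr_ge0.
  - by apply: measurable_funD => //; exact: measurable_funD.
  rewrite (intD (fun w => 7 * n%:R + K w))//; first last.
  - by move=> w; rewrite addr_ge0.
  - exact: measurable_funD.
  rewrite (intD (cst (7 * n%:R)))//.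
  have -> : (\int[P]_w (cst (7 * n%:R) w : R)%:E = (7 * n%:R)%:E)%E.
    transitivity (\int[P]_w (cst (7 * n%:R)%:E w))%E; first exact: eq_integral.
    by rewrite integral_cst//= probability_setT mule1.
  apply: (@le_trans _ _ ((7 * n%:R)%:E + 1%:E + (2 * n%:R)%:E + (2 * n%:R)%:E)%E).
    by rewrite !leeD// ?fin_k// ?fin_D.
  by rewrite -!EFinD lee_fin; have := n1; lra.
have [offi off0] := off_diag_mean.
have iH : P.-integrable setT (fun w => (H w)%:E).
  apply/integrableP; split; first exact/measurable_EFinP.
  under eq_integral do rewrite /= ger0_norm//.
  by apply: le_lt_trans intH _; rewrite ltry.
have ioff : P.-integrable setT (fun w => (lam / n%:R * off_diag l (e w))%:E).
  by under eq_fun do rewrite EFinM; exact: integrableZl.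
pose f w := H w - lam / n%:R * off_diag l (e w).
have mc0 w : 0 <= misclass l (fun j => Num.sg (vhat w 0 j)).
  rewrite /misclass mulr_ge0 ?invr_ge0 ?ler0n// le_min.
  by apply/andP; split; apply: sumr_ge0 => j _; rewrite ler0n.
(* [f] dominates a nonnegative quantity, so the nonnegative integral applies to it although
   [off_diag] is signed. *)
have f0 w : 0 <= f w by apply: le_trans (key w); rewrite mulr_ge0// ltW.
have mf : measurable_fun setT f.
  apply: measurable_funB => //; apply: measurable_funM => //.
  by apply/measurable_EFinP; case/integrableP: offi.
apply: (@le_trans _ _ (\int[P]_w (c^-1 * f w)%:E)%E).
  apply: le_integral_nonmeasurable => w; rewrite lee_fin//.
  by rewrite mulrC ler_pdivlMr// mulrC.
rewrite ge0_integralZl_real ?invr_ge0 ?(ltW c0)//.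
have -> : (\int[P]_w (f w)%:E = \int[P]_w (H w)%:E)%E.
  rewrite /f; under eq_integral do rewrite EFinB.
  rewrite integralB_EFin//.
  under [X in (_ - X)%E]eq_integral do rewrite EFinM.
  by rewrite integralZl// off0 mule0 sube0.
(* Here [c = n ^+ 2 * m2 / (32 * B)], so [12 * n / c] is [384 * B / (n * m2)]. *)
apply: (le_trans (lee_wpmul2l _ intH)); first by rewrite lee_fin invr_ge0 ltW.
rewrite -EFinM lee_fin le_eqVlt; apply/orP; left; apply/eqP.
by rewrite /c /lam; field; rewrite !gt_eqF.
Qed.

End Expectation.

(** * From the three scale conditions to the stated ratio *)

Theorem theorem4p1 (R : realType) :
  exists C : R, 0 < C /\
  forall (n p : nat) (mu : 'I_p -> R) (l : 'I_n -> R) (sigma : 'I_p -> R)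
    (d : measure_display) (T : measurableType d) (P : probability T R)
    (eps : 'I_p * 'I_n -> T -> R) (vhat : T -> 'rV[R]_n),
    (forall j, l j = 1 \/ l j = -1) ->
    (forall i, 0 <= sigma i) ->
    (forall ij, measurable_fun setT (eps ij)) ->
    mutually_independent P eps ->
    (forall ij B, measurable B ->
       P (eps ij @^-1` B) = gauss_law (sigma ij.1) B) ->
    let Y : T -> 'M[R]_(n, p) :=
      fun w => \matrix_(j < n, i < p) (l j * mu i + eps (i, j) w) in
    (forall w, unit_leading_eigvec (Y w *m (Y w)^T) (vhat w)) ->
    let lhat : T -> 'I_n -> R := fun w j => Num.sg (vhat w 0 j) in
    (\int[P]_w (misclass l (lhat w))%:E <=
     (C * min1_ratio
        (n%:R * l2norm mu * sigma_star sigma + n%:R * sigma_star sigma ^+ 2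
         + Num.sqrt n%:R * sigma_tilde_sq sigma)
        (n%:R * l2norm mu ^+ 2))%:E)%E.
Proof.
exists 384; split; first by rewrite ltr0n.
move=> n p mu l sigma d T P eps vhat hl sigma0 meps indeps laweps.
move=> Y hv; cbv zeta; pose lhat w j := Num.sg (vhat w 0 j).
have le1 : (\int[P]_w (misclass l (lhat w))%:E <= 1)%E.
  apply: (@le_trans _ _ (\int[P]_w (cst 1 w))%E).
    apply: le_integral_nonmeasurable => w; rewrite lee_fin ?misclass_le1//.
    rewrite /misclass mulr_ge0 ?invr_ge0 ?ler0n// le_min.
    by apply/andP; split; apply: sumr_ge0 => j _; rewrite ler0n.
  by rewrite integral_cst//= probability_setT mul1e.
set m2 := \sum_i mu i ^+ 2.
have m2_ge0 : 0 <= m2 by apply: sumr_ge0 => i _; exact: sqr_ge0.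
have norm2 : l2norm mu ^+ 2 = m2 by rewrite sqr_sqrtr.
(* A zero denominator means [n = 0] or [mu = 0]; the trivial bound 1 is then enough. *)
rewrite /min1_ratio; case: eqVneq => [_|den0].
  by apply: (le_trans le1); rewrite lee_fin mulr1 ler1n.
set den := _ * l2norm mu ^+ 2 in den0 *; set num := _ + _.
have nN0 : n%:R != 0 :> R by apply: contra den0; rewrite /den => /eqP ->; rewrite mul0r.
have n_gt0 : (0 < n)%N by rewrite lt0n; apply: contra nN0 => /eqP ->.
have nR : (0 : R) < n%:R by rewrite ltr0n.
have m2_gt0 : 0 < m2.
  rewrite lt_def m2_ge0 andbT; apply: contra den0 => /eqP m20.
  by rewrite /den norm2 m20 mulr0.
have den_gt0 : 0 < den by rewrite /den norm2 mulr_gt0.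
set ss := sigma_star sigma in num *.
have sle i : sigma i <= ss by exact: (le_bigmax _ sigma i).
have ss0 : 0 <= ss by exact: bigmax_ge_id.
pose a1 := n%:R * l2norm mu * ss; pose a2 := n%:R * ss ^+ 2.
pose a3 := Num.sqrt n%:R * sigma_tilde_sq sigma.
have a10 : 0 <= a1 by rewrite /a1 !mulr_ge0 ?ler0n ?sqrtr_ge0.
have a20 : 0 <= a2 by rewrite /a2 mulr_ge0 ?ler0n ?sqr_ge0.
have a30 : 0 <= a3 by rewrite /a3 mulr_ge0 ?sqrtr_ge0.
have numE : num = a1 + a2 + a3 by [].
have s2 i : sigma i ^+ 2 <= ss ^+ 2 by rewrite ler_pXn2r ?nnegrE ?sigma0.
have bound B : 0 < B -> num <= B ->
    (\int[P]_w (misclass l (lhat w))%:E <= (384 * B / den)%:E)%E.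
  move=> B0 numB; rewrite /den norm2.
  apply: (@expected_misclass R n p mu sigma l d T P eps n_gt0 hl meps indeps laweps B B0) => //.
  - apply: (@le_trans _ _ (a1 ^+ 2)); last by rewrite lerXn2r ?nnegrE ?(ltW B0)//; lra.
    rewrite /a1 !exprMn norm2 -mulrA ler_wpM2l ?sqr_ge0// /m2 mulr_suml.
    by apply: ler_sum => i _; rewrite ler_wpM2l ?sqr_ge0.
  - move=> i; apply: (@le_trans _ _ a2); last by lra.
    by rewrite /a2 ler_wpM2l ?ler0n.
  - apply: (@le_trans _ _ (a3 ^+ 2)); last by rewrite lerXn2r ?nnegrE ?(ltW B0)//; lra.
    rewrite /a3 exprMn !sqr_sqrtr ?ler0n//.
    by apply: sumr_ge0 => i _; rewrite exprn_even_ge0.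
have ratio : (\int[P]_w (misclass l (lhat w))%:E <= (384 * (num / den))%:E)%E.
  (* [num] vanishes when all [sigma i] do, while [B] must be positive: [B = num + del] is used, and
     this [del] raises the bound by exactly [r]. *)
  apply/lee_addgt0Pr => r r0; pose del := r * den / 384.
  have del0 : 0 < del by apply: divr_gt0; [exact: mulr_gt0|rewrite ltr0n].
  apply: le_trans (bound (num + del) _ _) _; [lra|lra|].
  rewrite -EFinD lee_fin le_eqVlt; apply/orP; left; apply/eqP.
  by rewrite /del; field; rewrite gt_eqF.
have [rle|rgt] := lerP (num / den) 1; first exact: ratio.
by apply: (le_trans le1); rewrite lee_fin mulr1 ler1n.
Qed.
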